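(* Let $G$ be a $3$-regular $2$-connected plane multigraph without loops. For every $2$-factor $X$ of $G$ having $n$ components, there exists a plane graph $J$ having a Hamilton cycle that contains no edge of $E(G)\setminus E(X)$, and such that $G \subseteq J \subset G^{2}$, $|E(J)| = |E(G)| + 2n - 2$, and $\Delta(J) \leqslant 5$. Moreover, if $G$ is simple, then $J$ is also simple.
   Context: A $2$-factor of a multigraph $G$ is a spanning $2$-regular subgraph of $G$. A Hamilton cycle is a cycle containing every vertex. For a connected graph $G$, the square $G^2$ is the graph on $V(G)$ in which two vertices are adjacent if and only if they have distance at most $2$ in $G$. $\Delta(J)$ denotes the maximum degree of $J$. *)

(* Defs.v *)
From mathcomp Require Import all_boot all_order all_algebra.
From mathcomp Require Import classical_sets reals.

Set Implicit Arguments.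
Unset Strict Implicit.
Unset Printing Implicit Defensive.

Import Order.TTheory GRing.Theory Num.Theory.
Local Open Scope ring_scope.
Local Open Scope classical_set_scope.

(* Finite multigraphs with vertex set V and edge set E; loops and parallel    *)
(* edges are allowed. The orientation of an edge is bookkeeping only: all     *)
(* notions below are invariant under exchanging src e and tgt e.              *)
Record multigraph (V E : finType) := Multigraph {
  src : E -> V;
  tgt : E -> V
}.

Section Multigraph.
Variables (V E : finType) (G : multigraph V E).

Definition joins (e : E) (x y : V) : bool :=
  ((src G e == x) && (tgt G e == y)) || ((src G e == y) && (tgt G e == x)).

(* For A : {pred E}, the suffix "_in G A" refers to the spanning subgraph of  *)
(* G with edge set A.                                                         *)
Definition adj_in (A : {pred E}) : rel V :=
  [rel x y | [exists e in A, joins e x y]].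

Definition adj : rel V := adj_in predT.

(* A loop contributes 2 to the degree of its vertex. *)
Definition degree_in (A : {pred E}) (v : V) : nat :=
  (#|[pred e in A | src G e == v]| + #|[pred e in A | tgt G e == v]|)%N.

Definition degree (v : V) : nat := degree_in predT v.

Definition max_degree : nat := (\max_(v : V) degree v)%N.

Definition regular (k : nat) : Prop := forall v, degree v = k.

Definition loopless : Prop := forall e, src G e != tgt G e.

Definition simple_graph : Prop :=
  loopless /\ (forall e f x y, joins e x y -> joins f x y -> e = f).

Definition connected_graph : Prop := forall x y, connect adj x y.

Definition adj_avoiding (w : V) : rel V :=
  [rel x y | [&& x != w, y != w & adj x y]].

(* The bound 1 < #|V| (instead of 2 < #|V|) makes the multigraph consisting   *)
(* of two vertices joined by three edges 2-connected, as is usual for         *)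
(* multigraphs; among 3-regular loopless multigraphs this is the only one on  *)
(* which the two conventions differ.                                          *)
Definition two_connected : Prop :=
  [/\ (1 < #|V|)%N, connected_graph &
      forall w x y, x != w -> y != w -> connect (adj_avoiding w) x y].

Definition two_factor (X : {set E}) : Prop :=
  forall v, degree_in (mem X) v = 2.

Definition components_in (A : {pred E}) : nat := n_comp (adj_in A) predT.

Definition distance_le (k : nat) (x y : V) : Prop :=
  exists p : seq V, [/\ path adj x p, last x p = y & (size p <= k)%N].

Definition square_adj (x y : V) : Prop := x != y /\ distance_le 2 x y.

(* A cycle v_0 e_0 v_1 e_1 ... v_(k-1) e_(k-1) v_0 is represented by the      *)
(* sequence of the pairs (v_i, e_i). Two parallel edges form a cycle of       *)
(* length 2, so distinctness of the edges has to be required separately.      *)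
Definition graph_cycle (c : seq (V * E)) : Prop :=
  [/\ c != [::], uniq [seq a.1 | a <- c], uniq [seq a.2 | a <- c] &
      cycle [rel a b : V * E | joins a.2 a.1 b.1] c].

Definition hamilton_cycle (c : seq (V * E)) : Prop :=
  graph_cycle c /\ forall v, v \in [seq a.1 | a <- c].

End Multigraph.

Section Polygonal.
Variable R : realType.
Implicit Types (x y z : R * R) (s : seq (R * R)).

Definition segment x y : set (R * R) :=
  [set z | exists2 t : R, 0 <= t <= 1 &
     z = ((1 - t) * x.1 + t * y.1, (1 - t) * x.2 + t * y.2)].

Fixpoint polyline x s : set (R * R) :=
  if s is y :: s' then segment x y `|` polyline y s' else [set x].

(* The polyline through x :: s does not revisit any of its points, i.e. it is *)
(* homeomorphic to [0, 1] (or is a single point if s is empty).               *)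
Fixpoint simple_polyline x s : Prop :=
  if s is y :: s' then
    [/\ x <> y, segment x y `&` polyline y s' `<=` [set y] &
        simple_polyline y s']
  else True.

(* The polyline through x :: s is a polygonal arc, or, if its first and last  *)
(* points coincide, a polygon (a simple closed polygonal curve).              *)
Definition simple_curve x s : Prop :=
  if s is y :: s' then
    [/\ x <> y, simple_polyline y s' &
        forall z, segment x y z -> polyline y s' z ->
          z = y \/ (z = x /\ x = last y s')]
  else False.

End Polygonal.

(* Plane multigraphs in the sense of Diestel's "Graph Theory": vertices are   *)
(* points of the plane and edges are polygonal arcs between their ends (or,   *)
(* for loops, polygons through their end). The edge e is drawn as the         *)
(* polyline with successive corners vpoint (src e), bends e, vpoint (tgt e).  *)
Section EdgeCurve.
Variables (R : realType) (V E : finType) (G : multigraph V E).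
Variables (vpoint : V -> R * R) (bends : E -> seq (R * R)).

Definition corners (e : E) : seq (R * R) :=
  rcons (bends e) (vpoint (tgt G e)).

Definition curve (e : E) : set (R * R) :=
  polyline (vpoint (src G e)) (corners e).

Definition curve_interior (e : E) : set (R * R) :=
  curve e `\` [set vpoint (src G e); vpoint (tgt G e)].

End EdgeCurve.

Record plane_multigraph (R : realType) (V E : finType) := PlaneMultigraph {
  pgraph :> multigraph V E;
  vpoint : V -> R * R;
  bends : E -> seq (R * R);
  vpoint_inj : injective vpoint;
  curve_simple : forall e,
    simple_curve (vpoint (src pgraph e)) (corners pgraph vpoint bends e);
  interior_vertex : forall e v,
    ~ curve_interior pgraph vpoint bends e (vpoint v);
  interior_edge : forall e f, e <> f ->
    curve_interior pgraph vpoint bends e `&` curve pgraph vpoint bends f = set0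
}.

Definition edge_set (R : realType) (V E : finType)
    (G : plane_multigraph R V E) (e : E) : set (R * R) :=
  curve G (vpoint G) (bends G) e.

(* iota exhibits G as a spanning plane subgraph of J: the same points as      *)
(* vertices, and every edge of G is an edge of J with the same ends and the   *)
(* same point set.                                                            *)
Definition plane_subgraph (R : realType) (V E F : finType)
    (G : plane_multigraph R V E) (J : plane_multigraph R V F)
    (iota : E -> F) : Prop :=
  [/\ injective iota,
      forall v, vpoint J v = vpoint G v,
      forall e x y, joins J (iota e) x y = joins G e x y &
      forall e, edge_set J (iota e) = edge_set G e].

(* J is contained in the square of G. The square is a simple graph whereas J  *)
(* may have parallel edges (those of G), so containment is that of adjacency; *)
(* in particular J has no loops.                                              *)
Definition sub_square (V E F : finType)
    (J : multigraph V F) (G : multigraph V E) : Prop :=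
  forall f x y, joins J f x y -> square_adj G x y.

(* Main.v *)
Require Import Defs.
From mathcomp Require Import all_boot all_order all_algebra.
From mathcomp Require Import classical_sets reals.
From mathcomp Require Import all_fingroup boolp zify ring lra.

(* Orient the cycles of [X], so that every vertex [y] has a successor, and let
   the third edge at [y] join it to its mate.  Choose a set [T] of n - 1 edges
   outside [X] that makes the cycles into a tree.  For every end [y] of an edge
   of [T], add an edge from the mate of [y] to the successor of [y], and follow
   it instead of the [X]-edge leaving the mate.  In terms of permutations, the
   successor map is composed with one transposition for each edge of [T]; each
   of them merges two orbits, so the result is a Hamilton cycle.  A vertex gets
   at most one new edge as a mate and one as a successor, so degrees are at
   most 5.

   The new edge at [y] is drawn close to the path formed by the two edges at
   [y].  The drawings do not interfere if, at both ends of an edge of [T], the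
   outgoing [X]-edge lies on the same rotational side of it; reversing whole
   components of the growing forest achieves this.  Polygonal arcs are pushed
   off a path one corner at a time, along the bisector of the free angle. *)

Set Implicit Arguments.
Unset Strict Implicit.
Unset Printing Implicit Defensive.

Import Order.TTheory GRing.Theory Num.Theory.
Import fintype finset fingraph.

(** * Tame sets and hugging arcs *)

(** At [y] there is only one edge besides the chord and the outgoing edge, so one side of the path
    from the mate through [y] to the successor is empty at [y]. The arc runs on that side, and the
    path is traversed so that this side is its left. The obstacle is that arcs compete for room
    along edges. An edge of [X] is followed by at most one arc, because it is the outgoing edge of a
    single vertex. A chord in [T] is followed by two, one for each of its ends. If it is the first
    edge of both paths, or the last edge of both, it is traversed in opposite directions and the two
    arcs lie on opposite sides of it. If it is the first edge of one path and the last edge of the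
    other, both arcs claim the same side. The side of the outgoing edge decides whether the chord
    comes first or last, and this is why the sides at its two ends have to agree. Since the edges of
    [T] join different cycles, the mate and the successor of an end lie on different cycles; hence
    no new edge is a loop, and the two edges of a path never have the same far end. *)

Section PlaneGeometry.
Local Open Scope ring_scope.
Variable R : realType.
Implicit Types (p q a b c g h u v w x y z : R * R) (s : seq (R * R)).
Implicit Types (K L : R * R -> Prop) (d e t l : R).

(** * Orientation and cyclic order of rays at a point *)

Definition orient p a b : R :=
  (a.1 - p.1) * (b.2 - p.2) - (a.2 - p.2) * (b.1 - p.1).

Definition dot p a b : R :=
  (a.1 - p.1) * (b.1 - p.1) + (a.2 - p.2) * (b.2 - p.2).

(* The rays from p through a, b, c occur in this counterclockwise order. *)
Definition cyc p a b c : bool :=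
  [|| (0 < orient p a b) && (0 < orient p b c),
      (0 < orient p b c) && (0 < orient p c a)
    | (0 < orient p c a) && (0 < orient p a b)].

(* The rays from p through a and b are distinct. *)
Definition diverge p a b : Prop := orient p a b = 0 -> dot p a b < 0.

Lemma orientC p a b : orient p b a = - orient p a b.
Proof. by rewrite /orient; ring. Qed.

Lemma dotC p a b : dot p b a = dot p a b.
Proof. by rewrite /dot; ring. Qed.

Lemma divergeC p a b : diverge p a b -> diverge p b a.
Proof.
move=> ab; rewrite /diverge orientC dotC => /eqP; rewrite oppr_eq0 => /eqP.
exact: ab.
Qed.

Lemma cyc_rot p a b c : cyc p a b c = cyc p b c a.
Proof. by rewrite /cyc; do 3 case: (0 < _). Qed.

Lemma plucker p a b c x :
  orient p a b * orient p c x - orient p a c * orient p b x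
    + orient p a x * orient p b c = 0.
Proof. by rewrite /orient; ring. Qed.

Lemma cyc_trans p a b c g : cyc p a b c -> cyc p b g c -> cyc p a g c.
Proof.
have := plucker p a b g c.
rewrite /cyc (orientC p a c) (orientC p c b).
(* The six orientations become arbitrary reals tied only by the Plücker relation, and each sign
   pattern is a polynomial inequality. *)
move: (orient p a b) (orient p c b) (orient p a c) (orient p a g)
  (orient p g c) (orient p b g) => A B C D E F H.
have [hE|hE] := ltP 0 E; have [hD|hD] := ltP 0 D;
  have [hC|hC] := ltP 0 (- C); rewrite ?andbT ?orbT ?andbF ?orbF //=;
  have [hA|hA] := ltP 0 A; have [hB|hB] := ltP 0 B;
  have [hB'|hB'] := ltP 0 (- B); have [hF|hF] := ltP 0 F => //= _ _; nra.
Qed.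

Lemma cyc_asym p a b c : cyc p a b c -> ~~ cyc p a c b.
Proof.
rewrite /cyc (orientC p b c) (orientC p c a) (orientC p a b).
have [?|?] := ltP 0 (orient p a b); have [?|?] := ltP 0 (orient p b c);
have [?|?] := ltP 0 (orient p c a); have [?|?] := ltP 0 (- orient p a b);
have [?|?] := ltP 0 (- orient p b c); have [?|?] := ltP 0 (- orient p c a);
  rewrite //=; lra.
Qed.

Lemma diverge_opposite p a b : diverge p a b -> orient p a b = 0 ->
  exists2 m : R, 0 < m &
    b.1 - p.1 = - m * (a.1 - p.1) /\ b.2 - p.2 = - m * (a.2 - p.2).
Proof.
move=> ab o0; have := ab o0; rewrite /dot; move: o0; rewrite /orient.
move: (a.1 - p.1) (a.2 - p.2) (b.1 - p.1) (b.2 - p.2) => A B C D o0 d0.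
have s0 : 0 < A * A + B * B.
  rewrite lt_neqAle addr_ge0 ?sqr_ge0 -?expr2 ?sqr_ge0 // andbT eq_sym.
  rewrite paddr_eq0 ?sqr_ge0 // !sqrf_eq0; apply/negP=> /andP[/eqP A0 /eqP B0].
  by move: d0; rewrite A0 B0; lra.
(* Minus the coefficient of the projection of [b - p] onto [a - p]. *)
exists (- ((A * C + B * D) / (A * A + B * B))).
  by rewrite oppr_gt0 pmulr_llt0 ?invr_gt0.
have AB : A * D = B * C by lra.
split; rewrite opprK; apply: (mulIf (lt0r_neq0 s0)).
  by rewrite mulrAC divfK ?lt0r_neq0 //; ring: AB.
by rewrite mulrAC divfK ?lt0r_neq0 //; ring: AB.
Qed.

Lemma cyc_total_opposite p a b c : diverge p a b -> diverge p b c ->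
  diverge p c a -> orient p a b = 0 -> cyc p a b c || cyc p a c b.
Proof.
move=> ab bc ca o0; have [m m0 [e1 e2]] := diverge_opposite ab o0.
have bcE : orient p b c = m * orient p c a.
  by rewrite /orient e1 e2; ring.
have dE : dot p b c = - m * dot p c a by rewrite /dot e1 e2; ring.
rewrite /cyc (orientC p b c) (orientC p c a) bcE.
have [o|o|o] := ltgtP (orient p c a) 0.
- have -> : 0 < - orient p c a by lra.
  have -> : 0 < - (m * orient p c a) by nra.
  by rewrite !orbT.
- have -> : 0 < m * orient p c a by nra.
  by rewrite ?orbT.
- have := ca o; have := bc; rewrite /diverge bcE o mulr0 dE => /(_ erefl).
  by nra.
Qed.

(** [cyc] asks for two positive signs among the three orientations, and the reversed order for two
    negative ones. If no orientation vanishes, one of the two majorities occurs; a vanishing one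
    means opposite rays and is treated apart. *)
Lemma cyc_total p a b c : diverge p a b -> diverge p b c -> diverge p c a ->
  cyc p a b c || cyc p a c b.
Proof.
move=> ab bc ca.
have [o1|n1] := eqVneq (orient p a b) 0; first exact: cyc_total_opposite.
have [o2|n2] := eqVneq (orient p b c) 0.
  by rewrite cyc_rot (cyc_rot _ a c) (cyc_rot _ c b) cyc_total_opposite.
have [o3|n3] := eqVneq (orient p c a) 0.
  by rewrite -(cyc_rot _ c a) (cyc_rot _ a c) cyc_total_opposite.
rewrite /cyc (orientC p b c) (orientC p c a) (orientC p a b) !oppr_gt0.
by move: n1 n2 n3; case: (ltgtP (orient p a b) 0) => // _ _;
  case: (ltgtP (orient p b c) 0) => // _ _;
  case: (ltgtP (orient p c a) 0).
Qed.

Lemma cyc_scale p a b c c' l : 0 < l ->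
  c'.1 = p.1 + l * (c.1 - p.1) -> c'.2 = p.2 + l * (c.2 - p.2) ->
  cyc p a b c' = cyc p a b c.
Proof.
move=> l0 e1 e2.
have o1 : orient p b c' = l * orient p b c by rewrite /orient e1 e2; ring.
have o2 : orient p c' a = l * orient p c a by rewrite /orient e1 e2; ring.
by rewrite /cyc o1 o2 !pmulr_rgt0.
Qed.

Lemma segmentP x y z : segment x y z <-> exists2 t, 0 <= t <= 1 &
  z.1 = x.1 + t * (y.1 - x.1) /\ z.2 = x.2 + t * (y.2 - x.2).
Proof.
split=> [[t t01 ->]|[t t01 [e1 e2]]]; exists t => //=; first by split; ring.
by rewrite (surjective_pairing z) e1 e2; congr (_, _); ring.
Qed.

Lemma pt_eq x y : x.1 = y.1 -> x.2 = y.2 -> x = y.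
Proof. by case: x y => [? ?] [? ?] /= -> ->. Qed.

Lemma segment_l x y : segment x y x.
Proof. by apply/segmentP; exists 0; [lra|split; ring]. Qed.

Lemma segmentC x y z : segment x y z -> segment y x z.
Proof.
move=> /segmentP[t /andP[t0 t1] [e1 e2]]; apply/segmentP; exists (1 - t).
  by apply/andP; split; lra.
by rewrite e1 e2; split; ring.
Qed.

Lemma segment_r x y : segment x y y.
Proof. exact/segmentC/segment_l. Qed.

(** If the two rays coincided, the end nearer to [p] would lie on both segments. *)
Lemma segment_diverge p a b : a <> p -> b <> p ->
  (forall z, segment p a z -> segment p b z -> z = p) -> diverge p a b.
Proof.
move=> ap bp sab o0; rewrite ltNge; apply/negP=> d0.
wlog le_ab : a b ap bp sab o0 d0 / dot p b b <= dot p a a.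
  move=> wl; have [|/ltW] := leP (dot p b b) (dot p a a); first exact: (wl a b).
  apply: (wl b a) => //; first by move=> z zb za; exact: sab.
  - by rewrite orientC o0 oppr0.
  - by rewrite dotC.
apply: bp; apply: (sab _ _ (segment_r _ _)); apply/segmentP.
have a0 : 0 < dot p a a.
  have a2 : 0 <= dot p a a by rewrite /dot -!expr2 addr_ge0 ?sqr_ge0.
  rewrite lt_neqAle a2 andbT eq_sym; apply/eqP => a3; apply: ap.
  move: a3; rewrite /dot -!expr2 => /eqP; rewrite paddr_eq0 ?sqr_ge0 //.
  rewrite !sqrf_eq0 => /andP[/eqP e1 /eqP e2]; 
  by apply: pt_eq; apply/eqP; rewrite -subr_eq0 ?e1 ?e2 eqxx.
have key : dot p a b * dot p a b = dot p b b * dot p a a.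
  have -> : dot p b b * dot p a a = dot p a b * dot p a b
     + orient p a b * orient p a b by rewrite /dot /orient; ring.
  by rewrite o0; ring.
exists (dot p a b / dot p a a).
  apply/andP; split; first by rewrite divr_ge0 // ltW.
  by rewrite ler_pdivrMr // mul1r; nra.
have n0 := lt0r_neq0 a0.
have aux (A B C D : R) : A * D - B * C = 0 ->
    (A * C + B * D) * A = C * (A * A + B * B) /\
    (A * C + B * D) * B = D * (A * A + B * B).
  move=> h; split; apply/eqP; rewrite -subr_eq0; apply/eqP.
    by transitivity (B * (A * D - B * C)); [ring|rewrite h mulr0].
  by transitivity (- A * (A * D - B * C)); [ring|rewrite h mulr0].
have [k1 k2] := aux _ _ _ _ o0.
rewrite -/(dot p a b) -/(dot p a a) in k1 k2.
split; rewrite mulrAC ?k1 ?k2 mulfK //; ring.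
Qed.

(** * Local structure of finite unions of segments *)

Definition near d x z : Prop := `|z.1 - x.1| < d /\ `|z.2 - x.2| < d.

Lemma near_le d e x z : d <= e -> near d x z -> near e x z.
Proof. by move=> de [h1 h2]; split; apply: lt_le_trans de. Qed.

(** Compactness of the unit interval, in the form used below: thresholds for [e] that work locally
    in [t] give a uniform one. The proof takes the supremum of all [t] such that one threshold
    serves the whole of [[0, t]]. *)
Lemma covering01 (Q : R -> R -> Prop) :
  (forall t, 0 <= t <= 1 -> exists2 d, 0 < d & forall t' e,
     0 <= t' <= 1 -> `|t' - t| < d -> 0 < e < d -> Q t' e) ->
  exists2 d, 0 < d & forall t e, 0 <= t <= 1 -> 0 < e < d -> Q t e.
Proof.
move=> loc.
pose A : set R := fun t => 0 <= t <= 1 /\ exists2 d, 0 < d &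
  forall t' e, 0 <= t' <= t -> 0 < e < d -> Q t' e.
have A0 : A 0.
  split; first by lra.
  have [|d d0 hd] := loc 0; first lra.
  exists d => // t e t0 he; apply: hd => //; first lra.
  have -> : t = 0 by lra.
  by rewrite subrr normr0.
have Aub : has_ubound A by exists 1 => u [/andP[]].
have supA : has_sup A by split=> //; exists 0.
set m := sup A.
have m01 : 0 <= m <= 1.
  apply/andP; split; first exact: ub_le_sup.
  by apply: ge_sup => [|u [/andP[]]//]; exists 0.
have [d d0 hd] := loc m m01.
have [u [u01 [d' d'0 hd']] um] := sup_adherent d0 supA.
rewrite -/m in um.
have um' : u <= m by apply: ub_le_sup => //; split=> //; exists d'.
have [m1|m1] := leP 1 m.
  exists (Order.min d d'); first by rewrite lt_min d0.
  move=> t e t01; rewrite lt_min => he; have [tu|ut] := leP t u.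
    by apply: hd'; lra.
  by apply: hd; rewrite ?ltr_norml; lra.
pose v := Order.min 1 (m + d / 2).
suff Av : A v.
  have := ub_le_sup Aub Av; rewrite -/m /v ge_min => /orP[]; lra.
have v1 : v <= 1 by rewrite /v ge_min lexx.
have v2 : v <= m + d / 2 by rewrite /v ge_min lexx orbT.
have v0 : 0 <= v by rewrite /v le_min; lra.
split; first lra.
exists (Order.min d d'); first by rewrite lt_min d0.
move=> t e t01; rewrite lt_min => he; have [tu|ut] := leP t u.
  by apply: hd'; lra.
by apply: hd; rewrite ?ltr_norml; lra.
Qed.

Lemma fin_small (I : finType) (Q : I -> R -> Prop) :
  (forall i, exists2 d, 0 < d & forall e, 0 < e < d -> Q i e) ->
  exists2 d, 0 < d & forall i e, 0 < e < d -> Q i e.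
Proof.
move=> loc; suff [d d0 hd] : exists2 d, 0 < d &
    forall i, i \in enum I -> forall e, 0 < e < d -> Q i e.
  by exists d => // i; apply: hd; rewrite mem_enum.
elim: (enum I) => [|i s [d d0 hd]]; first by exists 1.
have [d' d'0 hd'] := loc i.
exists (Order.min d d'); first by rewrite lt_min d0.
move=> j; rewrite inE => /orP[/eqP->|js] e; rewrite lt_min.
  by move=> he; apply: hd'; lra.
by move=> he; apply: hd => //; lra.
Qed.

Definition closed_set K : Prop :=
  forall z, ~ K z -> exists2 d, 0 < d & forall u, near d z u -> ~ K u.

(** Near every point [q] the set coincides with a cone of apex [q]. Unlike closedness alone, this
    prevents [K] from approaching an edge tangentially at one of its ends. *)
Definition conic K : Prop := forall q, exists2 d, 0 < d &
  forall z z' l, K z -> near d q z -> near d q z' -> 0 < l ->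
    z'.1 = q.1 + l * (z.1 - q.1) -> z'.2 = q.2 + l * (z.2 - q.2) -> K z'.

(* Finite unions of segments are tame. *)
Definition tame K : Prop := closed_set K /\ conic K.

Lemma near_mul (M l d x : R) : `|x| <= M -> `|l| * (M + 1) < d ->
  `|l * x| < d.
Proof.
move=> xM lM; rewrite normrM; apply: le_lt_trans lM.
by apply: ler_pM => //; lra.
Qed.

Lemma closed_segment a b : closed_set (segment a b).
Proof.
pose M := `|b.1 - a.1| + `|b.2 - a.2|.
have M1 : `|b.1 - a.1| <= M by rewrite lerDl.
have M2 : `|b.2 - a.2| <= M by rewrite lerDr.
have M0 : 0 <= M by rewrite addr_ge0.
move=> z nz.
have [|e e0 he] := @covering01 (fun t e => ~ (near e z
    (a.1 + t * (b.1 - a.1), a.2 + t * (b.2 - a.2)))).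
  move=> t t01; pose x := (a.1 + t * (b.1 - a.1), a.2 + t * (b.2 - a.2)).
  have xz : x <> z.
    by move=> xz; apply: nz; rewrite -xz; apply/segmentP; exists t.
  pose N := Order.max `|z.1 - x.1| `|z.2 - x.2|.
  have N0 : 0 < N.
    rewrite lt_max !normr_gt0; apply/negPn/negP; rewrite negb_or !negbK.
    rewrite !subr_eq0 => /andP[/eqP e1 /eqP e2]; apply: xz.
    exact: pt_eq.
  exists (N / (2 * (M + 1))); first by rewrite divr_gt0 //; lra.
  move=> t' e t'01 tt' /andP[e0 eN] [].
  have : e <= N / 2.
    apply: ltW; apply: lt_le_trans eN _; rewrite invfM mulrA.
    by rewrite ler_pdivrMr ?ler_peMr //; lra.
  have tN : `|t' - t| * (M + 1) < N / 2.
    rewrite -ltr_pdivlMr; last lra.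
    by rewrite -mulrA -invfM.
  have := near_mul M1 tN; have := near_mul M2 tN; rewrite /= => k2 k1 eN2 h1 h2.
  have : N < N; last by rewrite ltxx.
  rewrite {1}/N gt_max /= ; apply/andP; split.
    move: k1 h1; rewrite !ltr_norml; lra.
  move: k2 h2; rewrite !ltr_norml; lra.
exists (e / 2); first lra.
move=> u [h1 h2] /segmentP[t t01 [e1 e2]]; apply: (he t (e / 2)) => //; first lra.
by rewrite -e1 -e2.
Qed.

Lemma tame_segment a b : tame (segment a b).
Proof.
split=> [|q]; first exact: closed_segment.
have [/segmentP[t0 t001 [q1 q2]]|nq] := pselect (segment a b q); last first.
  have [d d0 hd] := closed_segment nq; exists d => // z z' l Kz nz.
  by have := hd _ nz Kz.
pose M := `|b.1 - a.1| + `|b.2 - a.2|.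
have M0 : 0 <= M by rewrite addr_ge0.
have [Mp|Mn] := ltP 0 M; last first.
  exists 1 => // z z' l H0 _ _ H3.
  have b1 : b.1 - a.1 = 0.
    apply/eqP; rewrite -normr_eq0; apply/eqP.
    by have := normr_ge0 (b.1 - a.1); have := normr_ge0 (b.2 - a.2);
      move: Mn; rewrite /M; lra.
  have b2 : b.2 - a.2 = 0.
    apply/eqP; rewrite -normr_eq0; apply/eqP.
    by have := normr_ge0 (b.1 - a.1); have := normr_ge0 (b.2 - a.2);
      move: Mn; rewrite /M; lra.
  move: H0 H3 => /segmentP[t _ [z1 z2]] l0 z'1 z'2.
  apply/segmentP; exists 0; first lra.
  by rewrite z'1 z'2 z1 z2 q1 q2 b1 b2; split; ring.
(* [h] keeps the parameter away from the ends of the segment. An end that is [q] itself needs no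
   such bound, because scaling about [q] respects it; the value 1 stands for this. *)
pose h := Order.min (if t0 == 0 then 1 else t0) (if t0 == 1 then 1 else 1 - t0).
have h0 : 0 < h.
  by rewrite /h lt_min; case: eqP => ?; case: eqP => ?; lra.
exists (h * M / 2) => [|z z' l /segmentP[t t01 [z1 z2]]].
  by rewrite divr_gt0 // mulr_gt0.
have small (m : R) x : near (h * M / 2) q x ->
    x.1 = q.1 + m * (b.1 - a.1) -> x.2 = q.2 + m * (b.2 - a.2) -> - h < m < h.
  move=> [h1 h2] x1 x2; rewrite -ltr_norml -(ltr_pM2r Mp) mulrDr -!normrM.
  have -> : m * (b.1 - a.1) = x.1 - q.1 by rewrite x1; ring.
  have -> : m * (b.2 - a.2) = x.2 - q.2 by rewrite x2; ring.
  lra.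
move=> nz nz' l0 z'1 z'2.
have m1 : - h < t - t0 < h.
  by apply: (small _ _ nz); rewrite ?z1 ?z2 ?q1 ?q2; ring.
have m2 : - h < l * (t - t0) < h.
  by apply: (small _ _ nz'); rewrite ?z'1 ?z'2 ?z1 ?z2 ?q1 ?q2; ring.
apply/segmentP; exists (t0 + l * (t - t0)); last first.
  by rewrite z'1 z'2 z1 z2 q1 q2; split; ring.
have hl : h <= if t0 == 0 then 1 else t0 by rewrite ge_min lexx.
have hr : h <= if t0 == 1 then 1 else 1 - t0 by rewrite ge_min lexx orbT.
move: hl hr; case: eqP => ?; case: eqP => ? hl hr; nra.
Qed.

Lemma tame_union K L : tame K -> tame L -> tame (fun z => K z \/ L z).
Proof.
move=> [cK hK] [cL hL]; split=> [z nKL|q].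
  have [nK nL] : ~ K z /\ ~ L z by split=> H; apply: nKL; [left|right].
  have [d d0 hd] := cK z nK; have [e e0 he] := cL z nL.
  exists (Order.min d e); first by rewrite lt_min d0.
  move=> u nu [] H; [apply: (hd u)|apply: (he u)] => //; apply: near_le nu;
    by rewrite ge_min lexx ?orbT.
have [d d0 hd] := hK q; have [e e0 he] := hL q.
exists (Order.min d e); first by rewrite lt_min d0.
have ld : Order.min d e <= d by rewrite ge_min lexx.
have le : Order.min d e <= e by rewrite ge_min lexx orbT.
move=> z z' l [] H n1 n2; [left|right].
  exact: (hd z z' l H (near_le ld n1) (near_le ld n2)).
exact: (he z z' l H (near_le le n1) (near_le le n2)).
Qed.

Lemma tame_ext K L : (forall z, K z <-> L z) -> tame K -> tame L.
Proof.
by move=> KL; have -> : L = K by apply/funext=> z; apply/propext; split=> /KL.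
Qed.

Lemma tame_empty : tame (fun=> False).
Proof.
by split=> [z _|q]; exists (1 : R); rewrite ?ltr01 // => u _ [].
Qed.

Lemma tame_bigU (I : finType) (P : pred I) (K : I -> R * R -> Prop) :
  (forall i, tame (K i)) -> tame (fun z => exists2 i, P i & K i z).
Proof.
move=> tK; suff H : tame (fun z => exists2 i, (i \in enum I) && P i & K i z).
  apply: tame_ext H => z; split=> [[i /andP[_ Pi] Kz]|[i Pi Kz]]; exists i => //.
  by rewrite mem_enum Pi.
elim: (enum I) => [|i s IHs].
  by apply: tame_ext tame_empty => z; split=> // [[i]].
have [Pi|nPi] := boolP (P i).
  apply: tame_ext (tame_union (tK i) IHs) => z; split.
    case=> [Kz|[j /andP[js Pj] Kz]]; first by exists i; rewrite // mem_head.
    by exists j; rewrite // inE js orbT.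
  move=> [j /andP[]]; rewrite inE => /orP[/eqP->|js] Pj Kz; first by left.
  by right; exists j; rewrite // js.
apply: tame_ext IHs => z; split=> [[j /andP[js Pj] Kz]|[j /andP[]]].
  by exists j; rewrite // inE js orbT.
rewrite inE => /orP[/eqP->|js] Pj Kz; first by rewrite Pj in nPi.
by exists j; rewrite // js.
Qed.

Lemma tame_polyline x s : tame (polyline x s).
Proof.
elim: s x => [|y s IHs] x /=; last exact/tame_union/IHs/tame_segment.
apply: tame_ext (tame_segment x x) => z; split=> [/segmentP[t _ [e1 e2]]|->].
  by apply: pt_eq; rewrite ?e1 ?e2 subrr mulr0 addr0.
exact: segment_l.
Qed.

(** * Moving one corner of a path into a free sector *)

(** The point with parameter [t] on the segment from [q] to the displaced corner [p + e * w]. *)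
Definition skew q p w (t e : R) : R * R :=
  (q.1 + t * (p.1 - q.1) + t * e * w.1, q.2 + t * (p.2 - q.2) + t * e * w.2).

Lemma near_skew q p w : exists2 M, 0 < M & forall t0 t e d,
  0 < d -> 0 <= t <= 1 -> `|t - t0| < d / M -> 0 < e < d / M ->
  near d (skew q p w t0 0) (skew q p w t e).
Proof.
pose M := `|p.1 - q.1| + `|p.2 - q.2| + (`|w.1| + `|w.2|).
have M0 : 0 <= M by rewrite !addr_ge0.
exists (2 * (M + 1)) => [|t0 t e d]; first lra.
move=> d0 t01 tt0 he.
have D : d / (2 * (M + 1)) * (M + 1) = d / 2.
  by rewrite invfM mulrA divfK //; lra.
have h1 : `|t - t0| * (M + 1) < d / 2 by rewrite -D ltr_pM2r //; lra.
have h2 : `|t * e| * (M + 1) < d / 2.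
  
  rewrite -D ltr_pM2r ?ger0_norm ?mulr_ge0; try lra.
  by apply: (@le_lt_trans _ _ e); [apply: ler_piMl; lra|lra].
have n1 := normr_ge0 (p.1 - q.1); have n2 := normr_ge0 (p.2 - q.2).
have n3 := normr_ge0 w.1; have n4 := normr_ge0 w.2.
have near1 (A W : R) : `|A| <= M -> `|W| <= M ->
    `|(t - t0) * A + t * e * W| < d.
  move=> AM WM; have := near_mul AM h1; have := near_mul WM h2.
  by rewrite !ltr_norml; lra.
split; rewrite /skew /=.
  have -> : forall A B C D : R, A + t * B + t * e * C - (A + t0 * B + D * 0 * C)
    = (t - t0) * B + t * e * C by move=> ????; ring.
  by apply: near1; rewrite /M; lra.
have -> : forall A B C D : R, A + t * B + t * e * C - (A + t0 * B + D * 0 * C)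
  = (t - t0) * B + t * e * C by move=> ????; ring.
by apply: near1; rewrite /M; lra.
Qed.

(* Near [q], conicity of [K] reduces the claim to a point inside the edge
   [q p]. *)
Lemma thin_triangle K q p w : tame K -> q <> p ->
  (forall z, K z -> segment q p z -> z = q \/ z = p) ->
  (exists2 d, 0 < d & forall z (l m : R), K z -> near d p z -> 0 <= l ->
     0 < m -> z.1 = p.1 + l * (q.1 - p.1) + m * w.1 ->
     z.2 = p.2 + l * (q.2 - p.2) + m * w.2 -> False) ->
  exists2 d, 0 < d & forall e, 0 < e < d ->
    forall z, K z -> segment q (p.1 + e * w.1, p.2 + e * w.2) z -> z = q.
Proof.
move=> [cK hK] qp Kqp [dp dp0 hp].
suff [d d0 hd] : exists2 d, 0 < d & forall t e, 0 <= t <= 1 -> 0 < e < d ->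
    0 < t -> ~ K (skew q p w t e).
  exists d => // e he z Kz /segmentP[t t01 /= [z1 z2]].
  have [t0|t0] := ltP 0 t.
    case: (hd t e t01 he t0); suff <- : z = skew q p w t e by [].
    by apply: pt_eq; rewrite ?z1 ?z2 /=; ring.
  have t0' : t = 0 by lra.
  by apply: pt_eq; rewrite ?z1 ?z2 t0'; ring.
have [M M0 f_near] := near_skew q p w.
have nKf t : 0 < t < 1 -> ~ K (skew q p w t 0).
  move=> t01 Kz.
  have z0 (x y W l : R) : 0 < l -> x + l * y + t * 0 * W = x -> y = 0.
    move=> l0 e; apply: (mulfI (lt0r_neq0 l0)); lra.
  have t0 : 0 < t by lra.
  have t1 : 0 < 1 - t by lra.
  apply: qp; have [|e|e] := Kqp _ Kz.
  - by apply/segmentP; exists t; [lra|rewrite /skew /=; split; ring].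
  - have k1 := z0 _ _ _ _ t0 (congr1 fst e).
    have k2 := z0 _ _ _ _ t0 (congr1 snd e).
    by apply: pt_eq; lra.
  have k1 : q.1 - p.1 = 0.
    by apply: (z0 p.1 _ w.1 _ t1); have := congr1 fst e; rewrite /skew /=; lra.
  have k2 : q.2 - p.2 = 0.
    by apply: (z0 p.2 _ w.2 _ t1); have := congr1 snd e; rewrite /skew /=; lra.
  by apply: pt_eq; lra.
apply: covering01 => t0 t001.
have [t0p|t0n] := ltP 0 t0; last first.
  have {t0n t001} -> : t0 = 0 by lra.
  have near0 t e d : 0 < d -> 0 <= t <= 1 -> t < d / M -> 0 < e < d / M ->
      near d q (skew q p w t e).
    move=> d0 t01 td he; have {1}-> : q = skew q p w 0 0.
      by apply: pt_eq; rewrite /=; ring.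
    by apply: f_near => //; rewrite subr0 ger0_norm; lra.
  have [d1 d10 h1] := hK q.
  (* A fixed parameter inside the edge, small enough for conicity at [q]. Scaling about [q] by
     [T / t] carries the point with parameter [t] to the one with parameter [T], near which
     closedness excludes [K]. *)
  pose T := Order.min 2^-1 (d1 / (2 * M)).
  have T0 : 0 < T by rewrite lt_min invr_gt0 divr_gt0 //; lra.
  have T1 : T <= 2^-1 by rewrite ge_min lexx.
  have T2 : T < d1 / M.
    apply: (@le_lt_trans _ _ (d1 / (2 * M))); first by rewrite ge_min lexx orbT.
    by rewrite ltr_pM2l // ltf_pV2 ?posrE; lra.
  have nK : ~ K (skew q p w T 0).
    apply: nKf; lra.
  have [d2 d20 h2] := cK _ nK.
  clearbody T; exists (Order.min T (d2 / M)).
    by rewrite lt_min T0 divr_gt0 //; lra.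
  move=> t e t01; rewrite !lt_min subr0 ger0_norm; last lra.
  move=> tT he tp Kf; apply: (h2 (skew q p w T e)).
    by apply: f_near; rewrite ?subrr ?normr0 ?divr_gt0 //; lra.
  apply: (h1 (skew q p w t e) _ (T / t) Kf); rewrite ?divr_gt0 //.
  - by apply: near0 => //; lra.
  - by apply: near0 => //; lra.
  - by rewrite /skew /=; field; rewrite lt0r_neq0.
  - by rewrite /skew /=; field; rewrite lt0r_neq0.
have [t01|t01] := ltP t0 1; last first.
  have {}t01 : t0 = 1 by lra.
  exists (dp / M); first by rewrite divr_gt0 //; lra.
  move=> t e t01' tt0 he t1 Kf.
  have nf := f_near t0 t e dp dp0 t01' tt0 he.
  have te : 0 < t * e by apply: mulr_gt0; lra.
  apply: (hp (skew q p w t e) (1 - t) (t * e) Kf) => //.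
  - have {1}<- : skew q p w t0 0 = p by apply: pt_eq; rewrite /skew /= t01; ring.
    by [].
  - by lra.
  - by rewrite /skew /=; ring.
  - by rewrite /skew /=; ring.
have nK : ~ K (skew q p w t0 0).
  by apply: nKf; lra.
have [d d0 hd] := cK _ nK.
exists (d / M); first by rewrite divr_gt0 //; lra.
by move=> t e t01' tt0 he _; apply/hd/f_near.
Qed.

Lemma orient_rot p a b : orient p a b = orient a b p.
Proof. by rewrite /orient; ring. Qed.

Lemma orient_pp p a : orient p a a = 0.
Proof. by rewrite /orient; ring. Qed.

Lemma orient_pl p a : orient p a p = 0.
Proof. by rewrite /orient; ring. Qed.

Lemma orient_affine p a x y z t : z.1 = x.1 + t * (y.1 - x.1) ->
  z.2 = x.2 + t * (y.2 - x.2) ->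
  orient p a z = (1 - t) * orient p a x + t * orient p a y.
Proof. by rewrite /orient => -> ->; ring. Qed.

Lemma orient_near p a x : 0 < orient p a x ->
  exists2 d, 0 < d & forall x', near d x x' -> 0 < orient p a x'.
Proof.
move=> o0; pose M := `|a.1 - p.1| + `|a.2 - p.2|.
have M0 : 0 <= M by rewrite addr_ge0.
have M1 : `|a.1 - p.1| <= M by rewrite lerDl.
have M2 : `|a.2 - p.2| <= M by rewrite lerDr.
exists (orient p a x / (2 * (M + 1))) => [|x' [h1 h2]].
  by rewrite divr_gt0 //; lra.
have D : orient p a x / (2 * (M + 1)) * (M + 1) = orient p a x / 2.
  by rewrite invfM mulrA divfK //; lra.
have k1 : `|x'.1 - x.1| * (M + 1) < orient p a x / 2.
  by rewrite -D ltr_pM2r //; lra.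
have k2 : `|x'.2 - x.2| * (M + 1) < orient p a x / 2.
  by rewrite -D ltr_pM2r //; lra.
have := near_mul M1 k2; have := near_mul M2 k1.
have -> : orient p a x' = orient p a x + (x'.2 - x.2) * (a.1 - p.1)
     - (x'.1 - x.1) * (a.2 - p.2) by rewrite /orient; ring.
by rewrite !ltr_norml; lra.
Qed.

Lemma orient_near2 p a x : 0 < orient p x a ->
  exists2 d, 0 < d & forall x', near d x x' -> 0 < orient p x' a.
Proof.
rewrite orient_rot orient_rot => /orient_near[d d0 hd]; exists d => // x' nx.
by rewrite orient_rot orient_rot hd.
Qed.

Lemma near_min d e x z : near (Order.min d e) x z -> near d x z /\ near e x z.
Proof. by move=> n; split; apply: near_le n; rewrite ge_min lexx ?orbT. Qed.

Lemma cyc_near p a c x : cyc p a x c ->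
  exists2 d, 0 < d & forall x', near d x x' -> cyc p a x' c.
Proof.
rewrite /cyc => /or3P[] /andP[].
- move=> /orient_near[d d0 hd] /orient_near2[e e0 he].
  exists (Order.min d e); rewrite ?lt_min ?d0 // => x' /near_min[n1 n2].
  by rewrite hd ?he.
- move=> /orient_near2[e e0 he] ->; exists e => // x' n1.
  by rewrite he // orbT.
move=> -> /orient_near[e e0 he]; exists e => // x' n1.
by rewrite he // !orbT.
Qed.

(** A sufficiently small counterclockwise turn away from [a] does not reach the ray of [c], be it to
    the left, to the right or opposite. The next lemma is the mirror image. *)
Lemma cyc_near_left p a c : diverge p a c -> exists2 d, 0 < d &
  forall x, near d a x -> 0 < orient p a x -> cyc p a x c.
Proof.
move=> ac; rewrite /cyc; have [o|o|o] := ltgtP (orient p a c) 0.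
- exists 1 => [|x nx ->]; first exact: ltr01.
  by rewrite (orientC p a c) oppr_gt0 o /= !orbT.
- have [d d0 hd] := orient_near2 o.
  by exists d => // x nx ->; rewrite hd.
have [m m0 [e1 e2]] := diverge_opposite ac o.
exists 1 => [|x nx ax]; first exact: ltr01.
have -> : orient p x c = m * orient p a x by rewrite /orient e1 e2; ring.
by rewrite mulr_gt0 // ax.
Qed.

Lemma cyc_near_right p a c : diverge p a c -> exists2 d, 0 < d &
  forall x, near d a x -> 0 < orient p x a -> cyc p x a c.
Proof.
move=> ac; rewrite /cyc; have [o|o|o] := ltgtP (orient p a c) 0.
- have : 0 < orient p c a by rewrite (orientC p a c) oppr_gt0.
  move=> /orient_near[d d0 hd].
  by exists d => // x nx ->; rewrite hd //= !orbT.
- by exists 1 => [|x nx ->]; rewrite ?ltr01.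
have [m m0 [e1 e2]] := diverge_opposite ac o.
exists 1 => [|x nx ax]; first exact: ltr01.
have -> : orient p c x = m * orient p x a by rewrite /orient e1 e2; ring.
by rewrite mulr_gt0 ?ax ?orbT //.
Qed.

(* [w] points into the angle at [p] counterclockwise from [b] to [q], which may
   be reflex. *)
Lemma sector_direction p q b : diverge p q b -> exists w,
  [/\ 0 < (b.1 - p.1) * w.2 - (b.2 - p.2) * w.1,
      0 < w.1 * (q.2 - p.2) - w.2 * (q.1 - p.1),
      forall z (l m : R), 0 <= l -> 0 < m ->
        z.1 = p.1 + l * (q.1 - p.1) + m * w.1 ->
        z.2 = p.2 + l * (q.2 - p.2) + m * w.2 -> ~~ cyc p q z b &
      forall z (l m : R), 0 <= l -> 0 < m ->
        z.1 = p.1 + l * (b.1 - p.1) + m * w.1 ->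
        z.2 = p.2 + l * (b.2 - p.2) + m * w.2 -> ~~ cyc p q z b].
Proof.
move=> qb.
suff [w [w1 w2 w3]] : exists w,
    [/\ 0 < (b.1 - p.1) * w.2 - (b.2 - p.2) * w.1,
      0 < w.1 * (q.2 - p.2) - w.2 * (q.1 - p.1) &
      (0 < orient p b q -> w = (b.1 - p.1 + (q.1 - p.1), b.2 - p.2 + (q.2 - p.2)))].
  (* Two of three signs must be positive for [cyc]. When [orient p b q] is one of them, the other
     two have to be negative; otherwise one negative sign is enough. Only the first case needs the
     exact formula for [w]. *)
  have key z : (0 < orient p b q -> orient p q z < 0 /\ orient p z b < 0) ->
      orient p q z < 0 \/ orient p z b < 0 -> ~~ cyc p q z b.
    have [o|o] := ltP 0 (orient p b q).
      move=> /(_ isT)[z1 z2] _; rewrite /cyc o.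
      by rewrite (lt_gtF z1) (lt_gtF z2).
    move=> _; rewrite /cyc (le_gtF o) andbF.
    by case=> /lt_gtF ->; rewrite ?andbF.
  exists w; split=> // z l m l0 m0 z1 z2.
    have o1 : orient p q z = - (m * (w.1 * (q.2 - p.2) - w.2 * (q.1 - p.1))).
      by rewrite /orient z1 z2; ring.
    have o1' : orient p q z < 0 by rewrite o1 oppr_lt0 mulr_gt0.
    apply: key; last by left.
    move=> o; split=> //; move: w3 => /(_ o) wE.
    have -> : orient p z b = - ((l + m) * orient p b q).
      by rewrite /orient z1 z2 wE /=; ring.
    by rewrite oppr_lt0 mulr_gt0 //; lra.
  have o1 : orient p z b = - (m * ((b.1 - p.1) * w.2 - (b.2 - p.2) * w.1)).
    by rewrite /orient z1 z2; ring.
  have o1' : orient p z b < 0 by rewrite o1 oppr_lt0 mulr_gt0.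
  apply: key; last by right.
  move=> o; split=> //; move: w3 => /(_ o) wE.
  have -> : orient p q z = - ((l + m) * orient p b q).
    by rewrite /orient z1 z2 wE /=; ring.
  by rewrite oppr_lt0 mulr_gt0 //; lra.
(* The sum of the two arms points into a convex angle and its negative into a reflex one; for a
   straight angle the arm to [b] is turned by a quarter. *)
have [o|o|o] := ltgtP (orient p b q) 0.
- exists (- (b.1 - p.1 + (q.1 - p.1)), - (b.2 - p.2 + (q.2 - p.2))).
  by move: o; rewrite /orient => o; split=> //=; lra.
- exists (b.1 - p.1 + (q.1 - p.1), b.2 - p.2 + (q.2 - p.2)).
  by move: o; rewrite /orient => o; split=> //=; lra.
have [m m0 [e1 e2]] := diverge_opposite (divergeC qb) o.
have s0 : 0 < (b.1 - p.1) ^+ 2 + (b.2 - p.2) ^+ 2.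
  have := divergeC qb o; rewrite /dot e1 e2.
  have -> : (b.1 - p.1) * (- m * (b.1 - p.1)) + (b.2 - p.2) * (- m * (b.2 - p.2))
    = - (m * ((b.1 - p.1) ^+ 2 + (b.2 - p.2) ^+ 2)) by ring.
  by rewrite oppr_lt0 pmulr_rgt0.
exists (- (b.2 - p.2), b.1 - p.1); split=> //=.
  by move: s0; rewrite !expr2; lra.
rewrite e1 e2.
have -> : - (b.2 - p.2) * (- m * (b.2 - p.2)) - (b.1 - p.1) * (- m * (b.1 - p.1))
  = m * ((b.1 - p.1) ^+ 2 + (b.2 - p.2) ^+ 2) by ring.
by rewrite mulr_gt0.
Qed.

(** The line through [p] and [p'] separates [q] from [b], so a segment to [q] and one to [b] can
    only meet on that line. Two segments with the common end [q], or [b], are not collinear. *)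
Lemma between_sector p q b p' : 0 < orient p b p' -> 0 < orient p p' q ->
  [/\ [/\ forall z, segment q p z -> segment q p' z -> z = q,
      forall z, segment q p z -> segment p' b z -> False,
      forall z, segment p b z -> segment p' b z -> z = b,
      forall z, segment p b z -> segment q p' z -> False &
      forall z, segment q p' z -> segment p' b z -> z = p'],
      q <> p', p' <> b & p' <> p].
Proof.
move=> u v.
have p'b : orient p p' b = - orient p b p' by rewrite orientC.
have p'p : p' <> p by move=> e; move: u; rewrite e orient_pl ltxx.
have hit0 z t t' : 0 <= t -> 0 <= t' ->
    orient p p' z = t * orient p p' q -> orient p p' z = - (t' * orient p b p') ->
    t = 0 /\ t' = 0.
  by move=> t0 t'0 -> h; nra.
have at_end x y z t : t = 0 -> z.1 = x.1 + t * (y.1 - x.1) ->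
    z.2 = x.2 + t * (y.2 - x.2) -> z = x.
  by move=> -> z1 z2; apply: pt_eq; rewrite ?z1 ?z2 mul0r addr0.
have at_end' x y z t : 1 - t = 0 -> z.1 = x.1 + t * (y.1 - x.1) ->
    z.2 = x.2 + t * (y.2 - x.2) -> z = y.
  have h : 1 - t = 0 -> t = 1 by lra.
  by move=> /h -> z1 z2; apply: pt_eq; rewrite ?z1 ?z2; ring.
split; first split=> z.
- move=> /segmentP[t t01 [z1 z2]] /segmentP[t' t'01 [z'1 z'2]].
  have := orient_affine q p z1 z2.
  rewrite (orient_affine q p z'1 z'2) orient_pl orient_pp [orient q p p']orient_rot.
  move=> h; have t0 : t' = 0 by apply: (mulIf (lt0r_neq0 v)); lra.
  exact: at_end z'1 z'2.
- move=> /segmentP[t t01 [z1 z2]] /segmentP[t' t'01 [z'1 z'2]].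
  have o1 := orient_affine p p' z1 z2; have o2 := orient_affine p p' z'1 z'2.
  have [h1 h2] : (1 - t) = 0 /\ t' = 0.
    apply: (hit0 z); [lra|lra| |].
      by rewrite o1 orient_pl; ring.
    by rewrite o2 orient_pp p'b; ring.
  by apply: p'p; rewrite -(at_end _ _ _ _ h2 z'1 z'2) (at_end' _ _ _ _ h1 z1 z2).
- move=> /segmentP[t t01 [z1 z2]] /segmentP[t' t'01 [z'1 z'2]].
  have := orient_affine p b z1 z2.
  rewrite (orient_affine p b z'1 z'2) orient_pl orient_pp.
  move=> h; have t0 : 1 - t' = 0 by apply: (mulIf (lt0r_neq0 u)); lra.
  exact: at_end' z'1 z'2.
- move=> /segmentP[t t01 [z1 z2]] /segmentP[t' t'01 [z'1 z'2]].
  have o1 := orient_affine p p' z1 z2; have o2 := orient_affine p p' z'1 z'2.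
  have [h1 h2] : (1 - t') = 0 /\ t = 0.
    apply: (hit0 z); [lra|lra| |].
      by rewrite o2 orient_pp; ring.
    by rewrite o1 orient_pl p'b; ring.
  by apply: p'p; rewrite -(at_end' _ _ _ _ h1 z'1 z'2) (at_end _ _ _ _ h2 z1 z2).
- move=> /segmentP[t t01 [z1 z2]] /segmentP[t' t'01 [z'1 z'2]].
  have o1 := orient_affine p p' z1 z2; have o2 := orient_affine p p' z'1 z'2.
  have [h1 h2] : (1 - t) = 0 /\ t' = 0.
    apply: (hit0 z); [lra|lra| |].
      by rewrite o1 orient_pp; ring.
    by rewrite o2 orient_pp p'b; ring.
  exact: at_end' h1 z1 z2.
- by move=> e; move: v; rewrite e orient_pp ltxx.
- by move=> e; move: u; rewrite e orient_pp ltxx.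
- by [].
Qed.

(** The free sector is the one on the left of the path from [q] through [p] to [b], that is,
    counterclockwise from [b] to [q]. Both bounding rays belong to it, since [cyc] is strict. *)
Definition sector_free K q p b : Prop := exists2 d, 0 < d &
  forall z, K z -> near d p z -> z <> p -> cyc p q z b.

(** [thin_triangle] is applied to both edges at [p] with the same direction into the free sector; a
    short enough displacement serves both. *)
Lemma corner_step K q p b d : tame K -> q <> p -> b <> p ->
  (forall z, segment q p z -> segment p b z -> z = p) ->
  (forall z, K z -> segment q p z -> z = q \/ z = p) ->
  (forall z, K z -> segment p b z -> z = p \/ z = b) ->
  sector_free K q p b -> 0 < d ->
  exists p', [/\ near d p p', 0 < orient p b p', 0 < orient p p' q,
    forall z, K z -> segment q p' z -> z = q &
    forall z, K z -> segment p' b z -> z = b].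
Proof.
move=> tK qp bp qpb Kqp Kpb [e e0 he] d0.
have qb : diverge p q b.
  by apply: segment_diverge => // z /segmentC; apply: qpb.
have [w [w1 w2 wq wb]] := sector_direction qb.
have wne z l (m : R) (a : R * R) : 0 < m -> (a = q \/ a = b) -> 0 <= l ->
    z.1 = p.1 + l * (a.1 - p.1) + m * w.1 ->
    z.2 = p.2 + l * (a.2 - p.2) + m * w.2 -> z <> p.
  move=> m0 ab l0 z1 z2 zp; rewrite zp in z1 z2.
  have h1 : l * (a.1 - p.1) = - (m * w.1) by lra.
  have h2 : l * (a.2 - p.2) = - (m * w.2) by lra.
  have h3 : (l * (a.1 - p.1)) * w.2 - (l * (a.2 - p.2)) * w.1 = 0.
    by rewrite h1 h2; ring.
  have h4 : l * ((a.1 - p.1) * w.2 - (a.2 - p.2) * w.1) = 0 by lra.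
  have h5 : l = 0 by move: h4; case: ab => ->; nra.
  have w10 : w.1 = 0.
    by move: h1; rewrite h5 mul0r => /esym/eqP; rewrite oppr_eq0 mulf_eq0
      (gt_eqF m0) => /eqP.
  have w20 : w.2 = 0.
    by move: h2; rewrite h5 mul0r => /esym/eqP; rewrite oppr_eq0 mulf_eq0
      (gt_eqF m0) => /eqP.
  by move: w1; rewrite w10 w20; lra.
have [d1 d10 h1] : exists2 d, 0 < d & forall e, 0 < e < d ->
    forall z, K z -> segment q (p.1 + e * w.1, p.2 + e * w.2) z -> z = q.
  apply: thin_triangle => //; exists e => // z l m Kz nz l0 m0 z1 z2.
  have zp : z <> p by apply: (wne z l m q) => //; left.
  by have := wq z l m l0 m0 z1 z2; rewrite he.
have [d2 d20 h2] : exists2 d, 0 < d & forall e, 0 < e < d ->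
    forall z, K z -> segment b (p.1 + e * w.1, p.2 + e * w.2) z -> z = b.
  apply: thin_triangle => //.
    by move=> z Kz /segmentC /(Kpb _ Kz)[]; [right|left].
  exists e => // z l m Kz nz l0 m0 z1 z2.
  have zp : z <> p by apply: (wne z l m b) => //; right.
  by have := wb z l m l0 m0 z1 z2; rewrite he.
pose M := `|w.1| + `|w.2|.
have M0 : 0 <= M by rewrite addr_ge0.
have M1 : `|w.1| <= M by rewrite lerDl.
have M2 : `|w.2| <= M by rewrite lerDr.
pose D := Order.min (Order.min d1 d2) (d / (M + 1)).
have D0 : 0 < D by rewrite !lt_min d10 d20 divr_gt0 //; lra.
have : 0 < D / 2 < D by lra.
rewrite {2}/D !lt_min; set f := D / 2 => /andP[f0 /andP[/andP[f1 f2] f3]].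
have fM : `|f| * (M + 1) < d by rewrite gtr0_norm // -ltr_pdivlMr //; lra.
exists (p.1 + f * w.1, p.2 + f * w.2); split.
- by split; rewrite /= addrAC subrr add0r; apply: near_mul fM.
- have -> : orient p b (p.1 + f * w.1, p.2 + f * w.2)
    = f * ((b.1 - p.1) * w.2 - (b.2 - p.2) * w.1) by rewrite /orient /=; ring.
  by rewrite mulr_gt0.
- have -> : orient p (p.1 + f * w.1, p.2 + f * w.2) q
    = f * (w.1 * (q.2 - p.2) - w.2 * (q.1 - p.1)) by rewrite /orient /=; ring.
  by rewrite mulr_gt0.
- by move=> z; apply: h1; rewrite f0.
by move=> z Kz /segmentC; apply: h2 => //; rewrite f0.
Qed.

(** * Polylines and arcs that hug a path *)

Lemma polyline_l x s : polyline x s x.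
Proof. by case: s => [//|y s]; left; apply: segment_l. Qed.

Lemma polyline_last x s : polyline x s (last x s).
Proof. by elim: s x => [//|y s IHs] x; right; apply: IHs. Qed.

Lemma polyline_cat x s1 s2 z :
  polyline x (s1 ++ s2) z <-> polyline x s1 z \/ polyline (last x s1) s2 z.
Proof.
elim: s1 x => [|y s1 IHs] x /=.
  by split=> [H|[->|//]]; [right|apply: polyline_l].
split=> [[H|/IHs[H|H]]|[[H|H]|H]]; first by left; left.
- by left; right.
- by right.
- by left.
- by right; apply/IHs; left.
- by right; apply/IHs; right.
Qed.

Lemma simple_polyline_cons x y s : simple_polyline x (y :: s) <->
  [/\ x <> y, forall z, segment x y z -> polyline y s z -> z = y
    & simple_polyline y s].
Proof.
split=> [[xy xyz H]|[xy xyz H]]; split=> //.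
  by move=> z z1 z2; apply: xyz; split.
by move=> z [z1 z2]; apply: xyz.
Qed.

Lemma simple_polyline_start x y s : simple_polyline x (y :: s) ->
  ~ polyline y s x.
Proof.
move=> /simple_polyline_cons[xy h _] px; apply: xy; apply: h px; exact: segment_l.
Qed.

Lemma simple_polyline_cat x s1 s2 : simple_polyline x (s1 ++ s2) <->
  [/\ simple_polyline x s1, simple_polyline (last x s1) s2 &
    forall z, polyline x s1 z -> polyline (last x s1) s2 z -> z = last x s1].
Proof.
elim: s1 x => [|y s1 IHs] x; first by split=> [H|[]].
rewrite [(y :: s1) ++ s2]/= [last x _]/=; split.
  move=> /simple_polyline_cons[xy h /IHs[h1 h2 h3]]; split=> //.
    apply/simple_polyline_cons; split=> // z z1 z2; apply: (h _ z1).
    by apply/polyline_cat; left.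
  move=> z [z1|z1] z2; last exact: h3.
  have zy : z = y by apply: (h _ z1); apply/polyline_cat; right.
  by rewrite zy in z2 *; apply: h3 => //; apply: polyline_l.
move=> [/simple_polyline_cons[xy h h1] h2 h3].
apply/simple_polyline_cons; split=> //.
  move=> z z1 /polyline_cat[z2|z2]; first exact: h.
  have zl : z = last y s1 by apply: h3 => //; left.
  by apply: (h _ z1); rewrite zl; apply: polyline_last.
by apply/IHs; split=> // z z1 z2; apply: h3 => //; right.
Qed.

Lemma polyline_rcons x s y z : polyline x (rcons s y) z <->
  polyline x s z \/ segment (last x s) y z.
Proof.
rewrite -cats1 polyline_cat /=; split=> [[H|[H|->]]|[H|H]].
- by left.
- by right.
- by right; apply: segment_r.
- by left.
- by right; left.
Qed.

Lemma simple_polyline_rcons x s y : simple_polyline x (rcons s y) <->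
  [/\ simple_polyline x s, last x s <> y &
    forall z, polyline x s z -> segment (last x s) y z -> z = last x s].
Proof.
rewrite -cats1 simple_polyline_cat; split=> [[h1 /simple_polyline_cons[xy _ _] h2]|[h1 xy h2]].
  by split=> // z z1 z2; apply: h2 => //; left.
split; first exact: h1.
  by apply/simple_polyline_cons; split=> // z _ ->.
by move=> z z1 [z2|z2]; apply: h2 => //; rewrite z2; apply: segment_r.
Qed.

Lemma polyline_rev x s y z :
  polyline y (rcons (rev s) x) z <-> polyline x (rcons s y) z.
Proof.
elim: s x => [|a s IHs] x.
  by split=> [[]|[]]; [move/segmentC; left|move->; left; apply: segment_l
    |move/segmentC; left|move->; left; apply: segment_l].
rewrite rev_cons polyline_rcons IHs last_rcons /=.
by split=> [[H|/segmentC H]|[/segmentC H|H]]; [right|left|right|left].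
Qed.

Lemma simple_polyline_rev x s y :
  simple_polyline x (rcons s y) -> simple_polyline y (rcons (rev s) x).
Proof.
elim: s x => [|a s IHs] x.
  move=> /simple_polyline_cons[xy _ _]; apply/simple_polyline_cons; split=> //.
  by move=> yx; apply: xy.
rewrite rcons_cons rev_cons => /simple_polyline_cons[xa h /IHs h'].
apply/simple_polyline_rcons; rewrite last_rcons; split; first exact: h'.
  by move=> ax; apply: xa.
by move=> z /polyline_rev z1 /segmentC z2; apply: h.
Qed.

(** Obstacles may touch the path at corners, but only outside the left sector. The first segment
    from [q] to [p] is excluded, because in the induction its start is a corner that has already
    been moved. *)
Fixpoint free_path K q p s : Prop :=
  if s is b :: s' then
    [/\ sector_free K q p b,
        forall u, K u -> segment p b u -> u = p \/ u = b & free_path K p b s']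
  else True.

Lemma sector_free_union K L q p b : sector_free K q p b ->
  sector_free L q p b -> sector_free (fun z => K z \/ L z) q p b.
Proof.
move=> [d d0 hd] [e e0 he]; exists (Order.min d e); first by rewrite lt_min d0.
by move=> z KL /near_min[n1 n2] zp; case: KL => ?; [apply: hd|apply: he].
Qed.

Lemma sector_free_sub K L q p b : (forall z, L z -> K z) ->
  sector_free K q p b -> sector_free L q p b.
Proof. by move=> LK [d d0 hd]; exists d => // z /LK; apply: hd. Qed.

Lemma sector_free_away L q p b : closed_set L -> ~ L p -> sector_free L q p b.
Proof. by move=> cL /cL[d d0 hd]; exists d => // z Lz nz; case: (hd z nz). Qed.

Lemma free_path_union K L q p s : closed_set L ->
  (forall u, L u -> polyline p s u -> False) ->
  free_path K q p s -> free_path (fun z => K z \/ L z) q p s.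
Proof.
move=> cL; elim: s q p => [//|b s IHs] q p Lp /= [sf Kpb fr]; split.
- apply: sector_free_union => //; apply: sector_free_away => // Lpp.
  exact: Lp Lpp (polyline_l _ _).
- by move=> u [Ku|Lu] hu; [apply: Kpb|case: (Lp u Lu); left].
- by apply: IHs => // u Lu hu; apply: (Lp u Lu); right.
Qed.

Lemma cyc_scale2 p a b b' c l : 0 < l ->
  b'.1 = p.1 + l * (b.1 - p.1) -> b'.2 = p.2 + l * (b.2 - p.2) ->
  cyc p a b' c = cyc p a b c.
Proof.
by move=> l0 e1 e2; rewrite -(cyc_rot _ c) -[in RHS](cyc_rot _ c) (cyc_scale _ _ l0 e1 e2).
Qed.

Lemma sector_free_segment q p b a : cyc p q a b ->
  sector_free (segment p a) q p b.
Proof.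
move=> qab; exists 1 => [|z /segmentP[t t01 [z1 z2]] _ zp]; first exact: ltr01.
have [t0|t0] := ltP 0 t; first by rewrite (cyc_scale2 _ _ t0 z1 z2).
have t0' : t = 0 by lra.
by case: zp; apply: pt_eq; rewrite ?z1 ?z2 t0' mul0r addr0.
Qed.

(** By induction on the path: the first corner is moved from [p] to [p'], and the rest of the arc
    hugs the path that starts at [p'] and continues with [b]. The last two conclusions say that the
    arc leaves [q] and enters [z] just to the left of the path; this decides which other corners at
    its ends remain free. *)
Lemma hug_path K q p s z d : tame K -> simple_polyline q (p :: rcons s z) ->
  (forall u, K u -> segment q p u -> u = q \/ u = p) ->
  free_path K q p (rcons s z) -> 0 < d ->
  exists h r, [/\ simple_polyline q (rcons (h :: r) z),
    forall u, polyline q (rcons (h :: r) z) u ->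
      K u \/ polyline q (p :: rcons s z) u -> u = q \/ u = z,
    near d p h /\ 0 < orient q p h &
    near d (last p s) (last h r) /\ 0 < orient z (last h r) (last p s)].
Proof.
elim: s K q p => [|b s IHs] K q p tK.
  move=> /simple_polyline_cons[qp qpz /simple_polyline_cons[pz _ _]] Kqp.
  move=> [sf Kpz _] d0.
  have zp : z <> p by move=> e; apply: pz.
  have [|h [nh o1 o2 s4 s5]] := corner_step tK qp zp _ Kqp Kpz sf d0.
    by move=> u u1 u2; apply: qpz => //; left.
  have [[s6 s7 s8 s9 s10] qh hz hp] := between_sector o1 o2.
  exists h, [::]; rewrite [last _ _]/= [last _ [::]]/=; split.
  - have hz1 : simple_polyline h [:: z].
      by apply/simple_polyline_cons; split=> // u _ ->.
    apply/simple_polyline_cons; split; [exact: qh| |exact: hz1].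
    move=> u u1 [u2|uz]; first exact: s10.
    by case: (s9 u) => //; rewrite uz; apply: segment_r.
  - have arcE u : polyline q [:: h; z] u -> segment q h u \/ segment h z u.
      by case=> [|[|->]]; [left|right|right; apply: segment_r].
    have pathE u : polyline q [:: p; z] u -> segment q p u \/ segment p z u.
      by case=> [|[|->]]; [left|right|right; apply: segment_r].
    move=> u /arcE[u1|u1] [Ku|/pathE[u2|u2]].
    + by left; apply: s4.
    + by left; apply: s6.
    + by case: (s9 u).
    + by right; apply: s5.
    + by case: (s7 u).
    + by right; apply: s8.
  - by rewrite orient_rot.
  - by rewrite orient_rot orient_rot.
move=> /simple_polyline_cons[qp qpz sp] Kqp [sf Kpb fr] d0.
rewrite rcons_cons in qpz sp *.
have bp : b <> p by move: sp => /simple_polyline_cons[pb _ _] e; apply: pb.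
have pbz u : segment p b u -> polyline b (rcons s z) u -> u = b.
  by move: sp => /simple_polyline_cons[_ h _]; apply: h.
have sb : simple_polyline b (rcons s z) by move: sp => /simple_polyline_cons[].
have qpb u : segment q p u -> segment p b u -> u = p.
  by move=> u1 u2; apply: qpz => //; left.
have npb : ~ polyline b (rcons s z) p := simple_polyline_start sp.
have nqb : ~ polyline b (rcons s z) q.
  move=> u2; apply: qp; apply: qpz; first exact: segment_l.
  by right.
(* While the first corner moves, the rest of the path is an obstacle too. *)
pose K1 u := K u \/ polyline b (rcons s z) u.
have tK1 : tame K1 by apply: tame_union => //; apply: tame_polyline.
have K1qp u : K1 u -> segment q p u -> u = q \/ u = p.
  by move=> [Ku|bu] u1; [apply: Kqp|right; apply: qpz => //; right].
have K1pb u : K1 u -> segment p b u -> u = p \/ u = b.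
  by move=> [Ku|bu] u1; [apply: Kpb|right; apply: pbz].
have sf1 : sector_free K1 q p b.
  apply: sector_free_union => //; apply: sector_free_away => //.
  by case: (tame_polyline b (rcons s z)).
pose c := head z s.
have [s' sE] : exists s', rcons s z = c :: s'.
  by rewrite /c; case: (s) => [|x s']; [exists [::]|exists (rcons s' z)].
have [cb sbc] : c <> b /\ (forall u, segment b c u -> segment p b u -> u = b).
  move: sb pbz; rewrite sE => /simple_polyline_cons[bc _ _] pbz.
  by split=> [e|u u1 u2]; [apply: bc|apply: pbz => //; left].
have bpc : diverge b p c.
  apply: segment_diverge => // [e|u /segmentC u1 u2]; first by apply: bp.
  exact: sbc.
have [e e0 he] := cyc_near_right bpc.
have de0 : 0 < Order.min d e by rewrite lt_min d0.
have [p' [/near_min[nd ne] o1 o2 s4 s5]] :=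
  corner_step tK1 qp bp qpb K1qp K1pb sf1 de0.
have [[s6 s7 s8 s9 s10] qp' p'b p'p] := between_sector o1 o2.
(* Seen from [b], the new corner lies on the free side of the old one. So the sector at [b] only
   shrinks, and the old segment from [b] to [p] is outside it. *)
have p'pc : cyc b p' p c.
  by apply: he => //; rewrite -orient_rot.
(* The remaining arc has to avoid the abandoned segments, which belong to the original path, as well
   as its own first segment. *)
pose L u := (segment q p u \/ segment q p' u) \/ segment p b u.
pose K' u := K u \/ L u.
have tame3 : tame (fun u => segment q p u \/ segment q p' u).
  by apply: tame_union; apply: tame_segment.
have tK' : tame K'.
  by do 2 (apply: tame_union => //); apply: tame_segment.
have away u : segment q p u \/ segment q p' u -> polyline b (rcons s z) u -> False.
  move=> [u1|u1] u2.
    by apply: npb; rewrite -(qpz u u1) //; right.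
  by apply: nqb; rewrite -(s4 u _ u1) //; right.
have nzqp' : ~ segment q p' z.
  move=> u1; apply: (away z); first by right.
  by have := polyline_last b (rcons s z); rewrite last_rcons.
have nbs : ~ (segment q p b \/ segment q p' b).
  by move=> /away; apply; apply: polyline_l.
have [|||h [r [a1 a2 [a3 a4] [a5 a6]]]] := IHs K' p' b tK' _ _ _ d0.
- apply/simple_polyline_cons; split; [exact: p'b| |exact: sb].
  by move=> u u1 u2; apply: s5 => //; right.
- move=> u [Ku|[[u2|u2]|u2]] u1.
  + by right; apply: s5 => //; left.
  + by case: (s7 u).
  + by left; apply: s10.
  + by right; apply: s8.
- have [sfb Kbc frc] : free_path K p b (c :: s') by rewrite -sE.
  move: away; rewrite sE => away; split.
  + apply: sector_free_union; last apply: sector_free_union.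
    * move: sfb => [e' e'0 he']; exists e' => // u Ku nu ub.
      exact: cyc_trans p'pc (he' u Ku nu ub).
    * by apply: sector_free_away => //; case: tame3.
    * apply: (sector_free_sub (K := segment b p)) => [u /segmentC//|].
      exact: sector_free_segment.
  + move=> u [Ku|[u2|u2]] u1; first exact: Kbc.
      by case: (away u) => //; left.
    by left; apply: sbc.
  + apply: free_path_union => //.
      have [//] : tame L by apply: tame_union => //; apply: tame_segment.
    move=> u [u1|u1] u2; first by apply: (away u) => //; right.
    have ub : u = b by rewrite sE in pbz; apply: pbz => //; right.
    by rewrite sE ub in sb u2; apply: simple_polyline_start sb u2.
exists p', (h :: r); split.
- rewrite rcons_cons; apply/simple_polyline_cons; split=> // u u1 u2.
  have [|//|uz] := a2 u u2; first by left; right; left; right.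
  by case: nzqp'; rewrite -uz.
- rewrite rcons_cons => u [u1|u1].
    case=> [Ku|[u2|[u2|u2]]].
    + by left; apply: s4 => //; left.
    + by left; apply: s6.
    + by case: (s9 u).
    + by left; apply: s4 => //; right.
  move=> obst; have obst' : K' u \/ polyline p' [:: b & rcons s z] u.
    case: obst => [Ku|[u2|[u2|u2]]]; first by left; left.
    + by left; right; left; left.
    + by left; right; right.
    + by right; right.
  have [up|->] := a2 u u1 obst'; last by right.
  have p'1 : segment q p' u by rewrite up; apply: segment_r.
  left; case: obst => [Ku|[u2|[u2|u2]]].
  + by apply: s4 => //; left.
  + exact: s6.
  + by case: (s9 u).
  + by apply: s4 => //; right.
- by split=> //; rewrite orient_rot.
- by [].
Qed.

Lemma free_path_tail K q p s : closed_set K -> simple_polyline p s ->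
  (forall u, K u -> polyline p s u -> u = p \/ u = last p s) ->
  sector_free K q p (head p s) -> free_path K q p s.
Proof.
move=> cK; elim: s q p => [//|b s IHs] q p ss Kps sf.
have np := simple_polyline_start ss.
move: (ss) => /simple_polyline_cons[pb h sb]; split=> //.
  move=> u Ku u1; have [->|ul] := Kps u Ku (or_introl u1); first by left.
  by right; apply: h => //; rewrite ul; apply: polyline_last.
case: s IHs Kps sf sb h np {ss} => [//|c s] IHs Kps sf sb h np.
have Kbs u : K u -> polyline b (c :: s) u -> u = b \/ u = last b (c :: s).
  move=> Ku u1; have [up|->] := Kps u Ku (or_intror u1); last by right.
  by case: np; rewrite -up.
apply: IHs => //; apply: sector_free_away => // Kb.
have [bp|bl] := Kps b Kb (or_introl (segment_r _ _)); first by apply: pb.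
have e : last c s = b := esym bl.
by have := polyline_last c s; rewrite e; apply: simple_polyline_start sb.
Qed.

(** Of all inner corners of two consecutive walks, only their junction [v] can touch [K]; at the
    others closedness provides the sector. The equation in the conclusion splits off the first
    corner, whichever walk supplies it. *)
Lemma free_walk_cat K q s v s' : closed_set K ->
  simple_polyline q (rcons s v) ->
  (forall u, K u -> polyline q (rcons s v) u -> u = q \/ u = v) ->
  sector_free K (last q s) v (head v s') ->
  simple_polyline v s' ->
  (forall u, K u -> polyline v s' u -> u = v \/ u = last v s') ->
  forall p s0, rcons s v ++ s' = p :: s0 -> free_path K q p s0.
Proof.
move=> cK + + + sv Kv; elim: s q => [|b s IHs] q ss Kq sf p s0 /= [<- <-].
  exact: free_path_tail.
have nq := simple_polyline_start ss.
move: ss => /= /simple_polyline_cons[qb h sb].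
case E : (rcons s v ++ s') => [//|c s1].
have Ev : exists s2, rcons s v = c :: s2.
  by case: (s) E => [[<- _]|x s2 [<- _]]; [exists [::]|exists (rcons s2 v)].
have [s2 s2E] := Ev.
have Kb u : K u -> polyline b (rcons s v) u -> u = v.
  by move=> Ku u1; have [uq|//] := Kq u Ku (or_intror u1); case: nq; rewrite -uq.
split.
- apply: sector_free_away => // Kbb.
  have bv := Kb b Kbb (polyline_l _ _).
  have e : last c s2 = v by rewrite -[LHS]/(last b (c :: s2)) -s2E last_rcons.
  have := polyline_last c s2; rewrite e -bv; rewrite s2E in sb.
  exact: simple_polyline_start sb.
- move=> u Ku u1; have uv : u = v by apply: Kb => //; rewrite s2E; left.
  right; move: sb; rewrite s2E => /simple_polyline_cons[_ hb _].
  have e : last c s2 = v by rewrite -[LHS]/(last b (c :: s2)) -s2E last_rcons.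
  by apply: hb => //; rewrite uv -e; apply: polyline_last.
- apply: (IHs b _ _ sf) => // u Ku u1; right; exact: Kb.
Qed.

Lemma sector_free_dir (K : R * R -> Prop) (q p b a : R * R) : sector_free K q p b ->
  a <> p -> (forall z, segment p a z -> K z) -> cyc p q a b.
Proof.
move=> [d d0 hd] ap pa.
pose M := `|a.1 - p.1| + `|a.2 - p.2|.
have M0 : 0 <= M by rewrite addr_ge0.
have M1 : `|a.1 - p.1| <= M by rewrite lerDl.
have M2 : `|a.2 - p.2| <= M by rewrite lerDr.
pose D := Order.min 1 (d / (M + 1)).
have D0 : 0 < D by rewrite lt_min ltr01 divr_gt0 //; lra.
have : 0 < D / 2 < D by lra.
rewrite {2}/D !lt_min; set l := D / 2 => /andP[l0 /andP[l1 l2]].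
have lM : `|l| * (M + 1) < d by rewrite gtr0_norm // -ltr_pdivlMr //; lra.
pose z : R * R := (p.1 + l * (a.1 - p.1), p.2 + l * (a.2 - p.2)).
rewrite -(@cyc_scale2 p q a z b l) //; apply: hd.
- by apply: pa; apply/segmentP; exists l => //; rewrite (ltW l0) ltW.
- by split; rewrite /= addrAC subrr add0r; apply: near_mul lM.
move=> zp; apply: ap.
have [z1 z2] : l * (a.1 - p.1) = 0 /\ l * (a.2 - p.2) = 0.
  by move: (congr1 fst zp) (congr1 snd zp) => /=; lra.
apply: pt_eq; apply/eqP; rewrite -subr_eq0; apply/eqP;
  by apply: (mulfI (lt0r_neq0 l0)); rewrite mulr0.
Qed.

End PlaneGeometry.

(** * Adding an arc to a plane multigraph *)

Section Incidence.
Variables (V E : finType) (G : multigraph V E).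

Definition incident (e : E) (v : V) : bool := (src G e == v) || (tgt G e == v).

Definition other_end (e : E) (v : V) : V :=
  if src G e == v then tgt G e else src G e.

Lemma inc_oth e v : incident e v -> incident e (other_end e v).
Proof. by rewrite /incident /other_end; case: (src G e == v); rewrite eqxx ?orbT. Qed.

Lemma incP e v w : incident e v -> incident e w -> w = v \/ w = other_end e v.
Proof.
rewrite /incident /other_end; have [<-|nv] := eqVneq (src G e) v.
  by move=> _ /orP[]/eqP ->; [left|right].
by move=> /= /eqP-> /orP[]/eqP ->; [right|left].
Qed.

Hypothesis loopG : loopless G.

Lemma oth_neq e v : incident e v -> other_end e v != v.
Proof.
rewrite /incident /other_end; have [<-|nv] := eqVneq (src G e) v => [_|_]; last by [].
by rewrite eq_sym loopG.
Qed.

Lemma othK e v : incident e v -> other_end e (other_end e v) = v.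
Proof.
rewrite /incident /other_end; have [<-|nv] := eqVneq (src G e) v => [_|/= /eqP tv].
  by rewrite (negPf (loopG e)).
by rewrite eqxx.
Qed.
End Incidence.

Section Walks.
Local Open Scope ring_scope.
Variables (R : realType) (V F : finType) (J : plane_multigraph R V F).
Implicit Types (e f a b : F) (v w t : V) (z : R * R).
Local Notation vp := (vpoint J).

Definition body e v : seq (R * R) :=
  if src J e == v then bends J e else rev (bends J e).

Definition walk e v : seq (R * R) := rcons (body e v) (vp (other_end J e v)).

(** The first corner after [v]; its ray stands for [e] in the rotation at [v]. *)
Definition dir e v : R * R := head (vp v) (walk e v).

Lemma edge_set_vpoint e v : edge_set J e (vp v) -> incident J e v.
Proof.
move=> ev; apply: contrapT => /negP; rewrite /incident negb_or => /andP[sv tv].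
apply: (@interior_vertex _ _ _ J e v); split=> // [[]] /vpoint_inj /eqP;
  by rewrite eq_sym ?(negPf sv) ?(negPf tv).
Qed.

Lemma edge_meet e f z : e != f -> edge_set J e z -> edge_set J f z ->
  exists2 v, z = vp v & incident J e v /\ incident J f v.
Proof.
move=> ef ez fz; have [v zv] : exists v, z = vp v.
  apply: contrapT => nz.
  have : (curve_interior J vp (bends J) e `&` curve J vp (bends J) f)%classic z.
    by split=> //; split=> // [[]] zE; apply: nz; rewrite zE; eexists.
  by rewrite interior_edge //; exact/eqP.
by exists v => //; split; apply: edge_set_vpoint; rewrite -zv.
Qed.

Hypothesis loopJ : loopless J.

Lemma corners_simple e : simple_polyline (vp (src J e)) (corners J vp (bends J) e).
Proof.
have := @curve_simple _ _ _ J e; rewrite /corners.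
case E : (rcons _ _) => [|y s]; first by case: (bends J e) E.
move=> [xy s1 h]; apply/simple_polyline_cons; split=> // z z1 z2.
have [//|[_ xl]] := h z z1 z2.
have : vp (src J e) = vp (tgt J e).
  by rewrite [LHS]xl -[last y s]/(last (vp (src J e)) (y :: s)) -E last_rcons.
by move=> /vpoint_inj /eqP; rewrite (negPf (loopJ e)).
Qed.

Lemma walk_simple e v : incident J e v -> simple_polyline (vp v) (walk e v).
Proof.
have := corners_simple e; rewrite /incident /walk /body /other_end /corners.
have [<-//|nv] := eqVneq (src J e) v.
by move=> h /= /eqP <-; apply: simple_polyline_rev.
Qed.

Lemma walk_set e v z : incident J e v -> polyline (vp v) (walk e v) z <-> edge_set J e z.
Proof.
rewrite /incident /walk /body /other_end /edge_set /curve /corners.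
have [<-//|nv] := eqVneq (src J e) v.
by move=> /= /eqP <-; apply: polyline_rev.
Qed.

Lemma body_oth e v : incident J e v -> body e (other_end J e v) = rev (body e v).
Proof.
rewrite /incident /body /other_end; have [<- _|nv /= /eqP tv] := eqVneq (src J e) v.
  by rewrite (negPf (loopJ e)).
by rewrite eqxx revK.
Qed.

Lemma dir_oth e v : incident J e v -> dir e (other_end J e v) = last (vp v) (body e v).
Proof.
move=> ev; rewrite /dir /walk body_oth // othK //.
by elim/last_ind: (body e v) => //= s x _; rewrite rev_rcons last_rcons.
Qed.

Lemma walkE e v : exists s, walk e v = dir e v :: s.
Proof.
by rewrite /dir /walk; case: (body e v) => [|x s]; [exists [::]|eexists].
Qed.

Lemma dir_neq e v : incident J e v -> dir e v <> vp v.
Proof.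
move=> /walk_simple; have [s ->] := walkE e v.
by move=> /simple_polyline_cons[xy _ _] /esym.
Qed.

Lemma dir_segment e v z : incident J e v -> segment (vp v) (dir e v) z -> edge_set J e z.
Proof.
by move=> ev h; apply/(walk_set _ ev); have [s ->] := walkE e v; left.
Qed.

Lemma dir_far_end e v : incident J e v ->
  segment (vp v) (dir e v) (vp (other_end J e v)) -> vp (other_end J e v) = dir e v.
Proof.
move=> /walk_simple; have [s sE] := walkE e v.
have : last (vp v) (walk e v) = vp (other_end J e v) by rewrite last_rcons.
rewrite sE /= => <- /simple_polyline_cons[_ h _] h1; apply: h => //.
exact: polyline_last.
Qed.

Lemma edge_sector e v (q c : R * R) : incident J e v -> cyc (vp v) q (dir e v) c ->
  sector_free (edge_set J e) q (vp v) c.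
Proof.
move=> ev cy; apply: (sector_free_sub (K := polyline (vp v) (walk e v))).
  by move=> z /(walk_set _ ev).
have [s sE] := walkE e v; have := walk_simple ev; rewrite sE => ss.
apply: sector_free_union; first exact: sector_free_segment.
apply: sector_free_away; last exact: simple_polyline_start ss.
by case: (tame_polyline (dir e v) s).
Qed.

(** The first segments are halved: parallel edges may also meet at their other end, and a half
    segment does not reach that far. *)
Lemma dir_diverge e f v : e != f -> incident J e v -> incident J f v ->
  diverge (vp v) (dir e v) (dir f v).
Proof.
move=> ef ev fv.
pose mid a : R * R := ((vp v).1 + 2^-1 * ((dir a v).1 - (vp v).1),
                       (vp v).2 + 2^-1 * ((dir a v).2 - (vp v).2)).
have mid_neq a : incident J a v -> mid a <> vp v.
  move=> av h; apply: (dir_neq av).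
  by apply: pt_eq; move: (congr1 fst h) (congr1 snd h) => /=; lra.
have mid_sub a z : segment (vp v) (mid a) z -> segment (vp v) (dir a v) z.
  move=> /segmentP[t t01 [z1 z2]]; apply/segmentP; exists (t / 2); first lra.
  by rewrite z1 z2 /=; split; field.
have mid_end a : incident J a v -> ~ segment (vp v) (mid a) (vp (other_end J a v)).
  move=> av h; have dE := dir_far_end av (mid_sub _ _ h).
  move: h => /segmentP[t t01]; rewrite dE /= => -[z1 z2].
  have h1 : (1 - t / 2) * ((dir a v).1 - (vp v).1) = 0 by lra.
  have h2 : (1 - t / 2) * ((dir a v).2 - (vp v).2) = 0 by lra.
  have t0 : 0 < 1 - t / 2 by lra.
  apply: (dir_neq av); apply: pt_eq; apply/eqP; rewrite -subr_eq0; apply/eqP;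
    by apply: (mulfI (lt0r_neq0 t0)); rewrite mulr0.
have : diverge (vp v) (mid e) (mid f).
  apply: segment_diverge; [exact: mid_neq|exact: mid_neq|].
  move=> z z1 z2.
  have [w zw [ew fw]] := edge_meet ef (dir_segment ev (mid_sub _ _ z1))
    (dir_segment fv (mid_sub _ _ z2)).
  have [wv|wv] := incP ev ew; first by rewrite zw wv.
  by case: (mid_end e ev); rewrite -wv -zw.
have oE : orient (vp v) (mid e) (mid f) = 4^-1 * orient (vp v) (dir e v) (dir f v).
  by rewrite /orient /mid /=; field.
have dE : dot (vp v) (mid e) (mid f) = 4^-1 * dot (vp v) (dir e v) (dir f v).
  by rewrite /dot /mid /=; field.
rewrite /diverge oE dE => div o; move: div.
by rewrite o mulr0 pmulr_rlt0 ?invr_gt0 // => /(_ erefl).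
Qed.

(* The sector at [t] on the left of the path entering along [a] and leaving
   along [b] contains no other edge. *)
Definition corner_free a t b : Prop :=
  sector_free (fun z => exists2 f, (f != a) && (f != b) & edge_set J f z)
    (dir a t) (vp t) (dir b t).

End Walks.

(** * The arc along two consecutive edges *)

Section NewArc.
Local Open Scope ring_scope.
Variables (R : realType) (V F : finType) (J : plane_multigraph R V F).
Hypothesis loopJ : loopless J.
Variables (a b : F) (y : V).
Hypotheses (ay : incident J a y) (by_ : incident J b y) (ab : a != b).
Local Notation x := (other_end J a y).
Local Notation z := (other_end J b y).
Hypotheses (xz : x != z) (fr : corner_free J a y b).
Local Notation vp := (vpoint J).

(** [a] and [b] are absent because they form the hugged path. The vertices are listed separately, as
    a vertex need not lie on any further edge. *)
Definition obstacle (u : R * R) : Prop :=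
  (exists2 f, (f != a) && (f != b) & edge_set J f u) \/
  (exists2 v : V, true & u = vp v).

Lemma tame_obstacle : tame obstacle.
Proof.
apply: tame_union; apply: tame_bigU => i; first exact: tame_polyline.
exact: (tame_polyline _ [::]).
Qed.

Lemma obstacle_edge f u : (f == a) || (f == b) -> obstacle u ->
  edge_set J f u -> exists2 v, u = vp v & incident J f v.
Proof.
move=> fab [[g gab gu]|[v _ ->]] fu; last first.
  by exists v => //; apply: edge_set_vpoint.
have [|v uv [fv _]] := edge_meet _ fu gu; last by exists v.
by apply: contraTneq fab => ->; rewrite negb_or.
Qed.

(** The walk along [a] from [x] to [y] and on along [b] to [z] is simple because [x] and [z] differ.
    Its only inner corner touched by an obstacle is [y], where the left sector is free by
    assumption. *)
Lemma new_arc d : 0 < d -> exists h r,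
  [/\ simple_polyline (vp x) (rcons (h :: r) (vp z)),
      forall u, polyline (vp x) (rcons (h :: r) (vp z)) u ->
        obstacle u \/ edge_set J a u \/ edge_set J b u -> u = vp x \/ u = vp z,
      near d (dir J a x) h /\ 0 < orient (vp x) (dir J a x) h &
      near d (dir J b z) (last h r) /\ 0 < orient (vp z) (last h r) (dir J b z)].
Proof.
move=> d0; have ax := inc_oth ay; have bz := inc_oth by_.
have xyE : other_end J a x = y by apply: othK.
have wx : walk J a x = rcons (body J a x) (vp y) by rewrite /walk xyE.
have yx : x != y by apply: oth_neq.
have yz : z != y by apply: oth_neq.
have [s0 sE] := walkE J a x.
have sx := walk_simple loopJ ax; have sy := walk_simple loopJ by_.
have setx u := walk_set u ax; have sety u := walk_set u by_.
have lastx : last (vp x) (walk J a x) = vp y by rewrite wx last_rcons.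
have lasty : last (vp y) (walk J b y) = vp z by rewrite last_rcons.
have simp : simple_polyline (vp x) (walk J a x ++ walk J b y).
  apply/simple_polyline_cat; rewrite lastx; split=> // u /setx u1 /sety u2.
  have [v -> [av bv]] := edge_meet ab u1 u2.
  have [->//|vx] := incP ay av; have [->//|vz] := incP by_ bv.
  by move: xz; rewrite -vx -vz eqxx.
have allE u : polyline (vp x) (walk J a x ++ walk J b y) u <->
    edge_set J a u \/ edge_set J b u.
  rewrite polyline_cat lastx; split=> [[/setx|/sety]|[/setx|/sety]]; by [left|right].
have Kx u : obstacle u -> edge_set J a u -> u = vp x \/ u = vp y.
  move=> Ku u1; have [|v -> av] := obstacle_edge _ Ku u1; first by rewrite eqxx.
  by have [->|->] := incP ay av; [right|left].
have Ky u : obstacle u -> edge_set J b u -> u = vp y \/ u = vp z.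
  move=> Ku u1; have [|v -> bv] := obstacle_edge _ Ku u1; first by rewrite eqxx orbT.
  by have [->|->] := incP by_ bv; [left|right].
have [cK _] := tame_obstacle.
pose p := dir J a x.
have [s sE2] : exists s, walk J a x ++ walk J b y = p :: rcons s (vp z).
  by exists (s0 ++ body J b y); rewrite sE /walk -rcons_cat.
have lastp : last p s = dir J b z.
  rewrite dir_oth // -[last p s]/(last p (p :: s)).
  have : rcons (walk J a x ++ body J b y) (vp z) = rcons (p :: s) (vp z).
    by rewrite rcons_cat [LHS]sE2.
  move=> /rcons_inj[<-]; rewrite last_cat.
  by rewrite (_ : last p _ = vp y) // -lastx sE.
have freeP : free_path obstacle (vp x) p (rcons s (vp z)).
  apply: (@free_walk_cat _ _ _ (body J a x) (vp y) (walk J b y)); rewrite -?wx //.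
  - by move=> u Ku /setx; apply: Kx.
  - rewrite -dir_oth // xyE; apply: sector_free_union; first exact: fr.
    have tV v : tame (fun u => u = vp v) by apply: (tame_polyline _ [::]).
    (* There are finitely many vertices, so some neighbourhood of [y] contains no other one. *)
    have [d' d'0 hd'] : exists2 d, 0 < d & forall v e, 0 < e < d ->
        v != y -> ~ near e (vp y) (vp v).
      apply: fin_small => v; have [->|nv] := eqVneq v y; first by exists 1; rewrite ?ltr01.
      have [cv _] := tV v; have [|e e0 he] := cv (vp y).
        by move=> /vpoint_inj e; rewrite e eqxx in nv.
      exists e => // e' he' _ ne'; apply: (he (vp v)) => //.
      by apply: near_le ne'; lra.
    exists (d' / 2) => [|u [v _ ->] nv vy]; first by rewrite divr_gt0.
    case: (hd' v (d' / 2)) => //; first lra.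
    by apply/eqP => e; apply: vy; rewrite e.
  - by move=> u Ku /sety u1; rewrite lasty; apply: Ky.
have Kqp u : obstacle u -> segment (vp x) p u -> u = vp x \/ u = p.
  move=> Ku u1; have [->|uy] := Kx u Ku (dir_segment ax u1); first by left.
  by right; rewrite uy -xyE; apply: dir_far_end => //; rewrite xyE -uy.
rewrite sE2 in simp allE.
have [h [r [h1 h2 h3 h4]]] := hug_path tame_obstacle simp Kqp freeP d0.
exists h, r; split=> //; last by rewrite -lastp.
by move=> u u1 [Ku|/allE u2]; apply: h2 => //; [left|right].
Qed.
End NewArc.

(** * Inserting arcs into a drawing *)

Section PlaneAdd.
Variables (R : realType) (V F : finType) (J : plane_multigraph R V F).
Variables (x z : V) (s : seq (R * R)).
Local Notation vp := (vpoint J).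
Hypothesis arc_simple : simple_polyline (vp x) (rcons s (vp z)).
Hypothesis arc_vertex : forall v, polyline (vp x) (rcons s (vp z)) (vp v) ->
  v = x \/ v = z.
Hypothesis arc_edge : forall f u, polyline (vp x) (rcons s (vp z)) u ->
  edge_set J f u -> u = vp x \/ u = vp z.

Definition add_graph : multigraph V (option F) :=
  Multigraph (fun o => if o is Some f then src J f else x)
             (fun o => if o is Some f then tgt J f else z).

Definition add_bends (o : option F) : seq (R * R) :=
  if o is Some f then bends J f else s.

Lemma add_curve_simple o : simple_curve (vp (src add_graph o))
  (corners add_graph vp add_bends o).
Proof.
case: o => [f|]; first exact: curve_simple.
move: arc_simple; rewrite /corners /=.
case: (s) => [|y s'] /simple_polyline_cons[xy h ss];
  by split=> // u u1 u2; left; apply: h.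
Qed.

Lemma add_interior_vertex o v : ~ curve_interior add_graph vp add_bends o (vp v).
Proof.
case: o => [f|]; first exact: interior_vertex.
by move=> [/arc_vertex[->|->]]; apply; [left|right].
Qed.

Lemma add_interior_edge o o' : o <> o' ->
  (curve_interior add_graph vp add_bends o `&`
    curve add_graph vp add_bends o')%classic = classical_sets.set0.
Proof.
case: o o' => [f|] [g|] oo //.
- by apply: interior_edge => fg; apply: oo; rewrite fg.
- rewrite predeqE => u; split=> // -[[fu nu] au].
  have [uE|uE] := arc_edge au fu; subst u.
    by case: (@interior_vertex _ _ _ J f x).
  by case: (@interior_vertex _ _ _ J f z).
rewrite predeqE => u; split=> // -[[au nu] gu].
by apply: nu; have [->|->] := arc_edge au gu; [left|right].
Qed.

Definition plane_add : plane_multigraph R V (option F) :=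
  PlaneMultigraph (@vpoint_inj _ _ _ J) add_curve_simple add_interior_vertex
    add_interior_edge.

End PlaneAdd.

Section AddEdge.
Local Open Scope ring_scope.
Variables (R : realType) (V F : finType) (J : plane_multigraph R V F).
Hypothesis loopJ : loopless J.
Local Notation vp := (vpoint J).

(** An arc leaving [x] just counterclockwise of [f] enters the free sector of the corner only if [f]
    is [b], the ray at which that sector begins. In the mirrored lemma below the excluded case is
    [a]. *)
Lemma corner_free_left f x a b : incident J f x -> incident J a x -> incident J b x ->
  a != b -> b != f -> corner_free J a x b ->
  exists2 d, 0 < d & forall h, near d (dir J f x) h ->
    0 < orient (vp x) (dir J f x) h -> cyc (vp x) (dir J a x) h (dir J b x).
Proof.
move=> fx ax bx ab bf fr; have [af|af] := eqVneq a f.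
  by rewrite -af; apply: cyc_near_left; apply: dir_diverge.
have [|d d0 hd] := @cyc_near _ (vp x) (dir J a x) (dir J b x) (dir J f x).
  apply: sector_free_dir fr _ _; first exact: dir_neq.
  move=> u /(dir_segment fx) fu; exists f => //.
  by rewrite eq_sym af eq_sym bf.
by exists d => // h nh _; apply: hd.
Qed.

Lemma corner_free_right f x a b : incident J f x -> incident J a x -> incident J b x ->
  a != b -> a != f -> corner_free J a x b ->
  exists2 d, 0 < d & forall h, near d (dir J f x) h ->
    0 < orient (vp x) h (dir J f x) -> cyc (vp x) (dir J a x) h (dir J b x).
Proof.
move=> fx ax bx ab af fr; have [bf|bf] := eqVneq b f.
  have [|d d0 hd] := @cyc_near_right _ (vp x) (dir J f x) (dir J a x).
    by apply: dir_diverge; rewrite // eq_sym.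
  by exists d => // h nh o; rewrite cyc_rot bf hd.
have [|d d0 hd] := @cyc_near _ (vp x) (dir J a x) (dir J b x) (dir J f x).
  apply: sector_free_dir fr _ _; first exact: dir_neq.
  move=> u /(dir_segment fx) fu; exists f => //.
  by rewrite eq_sym af eq_sym bf.
by exists d => // h nh _; apply: hd.
Qed.

(** The last clause makes the insertion repeatable. Its conditions [b' != a] and [a' != b] exclude
    corners whose own arc would follow one of the two edges on the same side. *)
Lemma add_edge a b y : incident J a y -> incident J b y -> a != b ->
  other_end J a y != other_end J b y -> corner_free J a y b ->
  exists J' : plane_multigraph R V (option F),
  [/\ vpoint J' = vpoint J,
      forall f, [/\ src J' (Some f) = src J f, tgt J' (Some f) = tgt J f
                  & bends J' (Some f) = bends J f],
      src J' None = other_end J a y, tgt J' None = other_end J b y &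
      forall a' t b', incident J a' t -> incident J b' t -> a' != b' ->
        t != y -> b' != a -> a' != b -> corner_free J a' t b' ->
        corner_free J' (Some a') t (Some b')].
Proof.
move=> ay by_ ab xz fr; set x := other_end J a y in xz *; set z := other_end J b y in xz *.
have ax : incident J a x by apply: inc_oth.
have bz : incident J b z by apply: inc_oth.
pose hyp a' t b' := [/\ incident J a' t /\ incident J b' t, a' != b', b' != a, a' != b &
  corner_free J a' t b'].
(* The tolerance must be fixed before the arc is drawn, so one bound is taken for all pairs of
   edges; pairs that form no relevant corner contribute 1. *)
have [d1 d10 hd1] : exists2 d, 0 < d & forall (i : F * F) e, 0 < e < d ->
    hyp i.1 x i.2 -> forall h, near e (dir J a x) h ->
    0 < orient (vp x) (dir J a x) h ->
    cyc (vp x) (dir J i.1 x) h (dir J i.2 x).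
  apply: fin_small => i.
  have [[[i1 i2] h1 h2 h3 h4]|nh] := pselect (hyp i.1 x i.2); last by exists 1; rewrite ?ltr01.
  have [d d0 hd] := corner_free_left ax i1 i2 h1 h2 h4.
  by exists d => // e ed _ h nh; apply: hd; apply: near_le nh; lra.
have [d2 d20 hd2] : exists2 d, 0 < d & forall (i : F * F) e, 0 < e < d ->
    hyp i.1 z i.2 -> forall h, near e (dir J b z) h ->
    0 < orient (vp z) h (dir J b z) ->
    cyc (vp z) (dir J i.1 z) h (dir J i.2 z).
  apply: fin_small => i.
  have [[[i1 i2] h1 h2 h3 h4]|nh] := pselect (hyp i.1 z i.2); last by exists 1; rewrite ?ltr01.
  have [d d0 hd] := corner_free_right bz i1 i2 h1 h3 h4.
  by exists d => // e ed _ h nh; apply: hd; apply: near_le nh; lra.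
pose d := Order.min d1 d2 / 2.
have d0 : 0 < Order.min d1 d2 by rewrite lt_min d10.
have dd : 0 < d < Order.min d1 d2 by rewrite /d; lra.
move: dd; rewrite lt_min => /andP[dp /andP[dd1 dd2]].
have [h [r [arc1 arc2 [nh oh] [nl ol]]]] := new_arc loopJ ay by_ ab xz fr dp.
rewrite -/x -/z in arc1 arc2 nh oh nl ol.
have arcv v : polyline (vp x) (rcons (h :: r) (vp z)) (vp v) -> v = x \/ v = z.
  move=> u1; have [||] := arc2 _ u1; first by left; right; exists v.
  - by move/vpoint_inj; left.
  - by move/vpoint_inj; right.
have arce f u : polyline (vp x) (rcons (h :: r) (vp z)) u -> edge_set J f u ->
    u = vp x \/ u = vp z.
  move=> u1 fu; apply: arc2 => //; have [fa|fa] := eqVneq f a.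
    by right; left; rewrite -fa.
  have [fb|fb] := eqVneq f b; first by right; right; rewrite -fb.
  by left; left; exists f; rewrite ?fa.
exists (plane_add arc1 arcv arce); split=> // a' t b' a't b't ab' ty b'a a'b cf.
have hypt : hyp a' t b' by [].
suff fa : sector_free (polyline (vp x) (rcons (h :: r) (vp z)))
    (dir J a' t) (vp t) (dir J b' t).
  apply: sector_free_sub (sector_free_union cf fa) => u [[f|] fab fu].
    by left; exists f.
  by right.
(* At an end of the arc only the adjacent segment needs care, as the rest stays away; any other
   vertex is off the arc altogether. *)
have [tx|tx] := eqVneq t x.
  subst t; apply: sector_free_union.
    by apply: sector_free_segment; apply: (hd1 (a', b') d) => //; rewrite dp.
  apply: sector_free_away; last exact: simple_polyline_start arc1.
  by case: (tame_polyline h (rcons r (vp z))).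
have [tz|tz] := eqVneq t z.
  subst t; have arc1' := simple_polyline_rev arc1.
  apply: (sector_free_sub (K := polyline (vp z) (rcons (rev (h :: r)) (vp x)))).
    by move=> u /polyline_rev.
  move: arc1'; rewrite lastI rev_rcons => arc1'; apply: sector_free_union.
    by apply: sector_free_segment; apply: (hd2 (a', b') d) => //; rewrite dp.
  apply: sector_free_away; last exact: simple_polyline_start arc1'.
  by case: (tame_polyline (last h r) (rcons (rev (belast h r)) (vp x))).
apply: sector_free_away.
  by case: (tame_polyline (vp x) (rcons (h :: r) (vp z))).
by move=> /arcv[tE|tE]; [rewrite tE eqxx in tx|rewrite tE eqxx in tz].
Qed.
End AddEdge.

Section Reindex.
Variables (R : realType) (V F F' : finType) (J : plane_multigraph R V F).
Variable (h : F' -> F).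
Hypothesis h_inj : injective h.

Definition pull_graph : multigraph V F' :=
  Multigraph (src J \o h) (tgt J \o h).

Lemma pull_interior_edge (e f : F') : e <> f ->
  (curve_interior pull_graph (vpoint J) (bends J \o h) e `&`
    curve pull_graph (vpoint J) (bends J \o h) f)%classic = classical_sets.set0.
Proof. by move=> ef; apply: interior_edge => /h_inj. Qed.

(** Renames edges along an injection; this turns the [option] types produced by repeated insertion
    back into a sum. *)
Definition pull_edges : plane_multigraph R V F' :=
  @PlaneMultigraph R V F' pull_graph (vpoint J) (bends J \o h)
    (@vpoint_inj _ _ _ J) (fun e => @curve_simple _ _ _ J (h e))
    (fun e => @interior_vertex _ _ _ J (h e)) pull_interior_edge.

Lemma pull_corner_free a t b :
  corner_free J (h a) t (h b) -> corner_free pull_edges a t b.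
Proof.
apply: sector_free_sub => u [f /andP[fa fb] fu]; exists (h f) => //.
by rewrite !(inj_eq h_inj) fa.
Qed.
End Reindex.
Arguments pull_edges {R V F F'} J {h} h_inj.

Section DrawArcs.
Variables (R : realType) (V E : finType) (G : plane_multigraph R V E).
Hypothesis loopG : loopless G.
Variables (S : {set V}) (a b : V -> E).
Hypotheses (aS : {in S, forall y, incident G (a y) y})
  (bS : {in S, forall y, incident G (b y) y})
  (ends_neq : {in S, forall y, other_end G (a y) y != other_end G (b y) y})
  (abS : {in S &, forall y y', a y != b y'})
  (freeS : {in S, forall y, corner_free G (a y) y (b y)}).

Definition drawn (S0 : {set V}) (J : plane_multigraph R V (E + {y | y \in S0})%type) :=
  [/\ vpoint J = vpoint G,
      forall e, [/\ src J (inl e) = src G e, tgt J (inl e) = tgt G e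
                  & bends J (inl e) = bends G e] &
      forall s, src J (inr s) = other_end G (a (val s)) (val s) /\
                tgt J (inr s) = other_end G (b (val s)) (val s)].

Lemma draw_arcs_sub (S0 : {set V}) : S0 \subset S ->
  exists2 J : plane_multigraph R V (E + {y | y \in S0})%type, drawn J &
    {in S, forall y, y \notin S0 -> corner_free J (inl (a y)) y (inl (b y))}.
Proof.
have [n] := ubnP #|S0|; elim: n S0 => // n IHn S0 S0n S0S.
have [S00|[y0 y0S0]] := set_0Vmem S0.
  have no (s : {y | y \in S0}) : False.
    by case: s => y; rewrite S00 inE.
  pose h (f : (E + {y | y \in S0})%type) : E := 
    match f with inl e => e | inr s => False_rect _ (no s) end.
  have h_inj : injective h.
    move=> [e|s] [e'|s'] /=; first by move=> ->.
    - by case: (no s').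
    - by case: (no s).
    - by case: (no s).
  exists (pull_edges G h_inj); last first.
    by move=> y yS _; apply: pull_corner_free; apply: freeS.
  by split=> // s; case: (no s).
pose S1 := S0 :\ y0.
have y0S : y0 \in S by apply: (subsetP S0S).
have S1n : (#|S1| < n)%N by rewrite (cardsD1 y0) y0S0 in S0n.
have S1S : S1 \subset S by apply: subset_trans S0S; apply: subD1set.
have [J1 [vJ gJ aJ] fJ] := IHn S1 S1n S1S.
have incE e v : incident J1 (inl e) v = incident G e v.
  by have [s t _] := gJ e; rewrite /incident s t.
have othE e v : other_end J1 (inl e) v = other_end G e v.
  by have [s t _] := gJ e; rewrite /other_end s t.
have loopJ : loopless J1.
  move=> [e|s]; first by have [-> -> _] := gJ e; apply: loopG.
  have [-> ->] := aJ s; apply: ends_neq.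
  by apply: (subsetP S1S); apply: valP.
have inl_neq y y' : y \in S -> y' \in S ->
    (inl (a y) : (E + {y | y \in S1})%type) != inl (b y').
  by move=> yS y'S; apply: contra_neq (abS yS y'S) => -[].
have y0S1 : y0 \notin S1 by rewrite !inE eqxx.
have [|||J2 [vJ2 gJ2 sJ2 tJ2 fJ2]] := add_edge loopJ _ _ (inl_neq _ _ y0S y0S) _
  (fJ _ y0S y0S1).
- by rewrite incE; apply: aS.
- by rewrite incE; apply: bS.
- by rewrite !othE; apply: ends_neq.
(* [insub] fails exactly for [y0], whose arc is the freshly added edge [None]. *)
pose h (f : (E + {y | y \in S0})%type) : option (E + {y | y \in S1})%type :=
  match f with
  | inl e => Some (inl e)
  | inr s => omap inr (insub (val s) : option {y | y \in S1})
  end.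
have h_inj : injective h.
  move=> [e|s] [e'|s'] //=.
  - by move=> [->].
  - by case: insubP.
  - by case: insubP.
  case: insubP => [u uS1 us|ns]; case: insubP => [u' u'S1 u's'|ns'] //=.
    by move=> [uu]; congr inr; apply: val_inj; rewrite /= -us -u's' uu.
  move=> _; congr inr; apply: val_inj; move: ns ns'.
  by rewrite !inE !(valP s) !(valP s') !andbT !negbK => /eqP e /eqP e'; rewrite /= e.
exists (pull_edges J2 h_inj).
  split=> [|e|s]; first by rewrite -vJ -vJ2.
    have [s1 t1 b1] := gJ2 (inl e); have [s2 t2 b2] := gJ e.
    by rewrite -s2 -t2 -b2 -s1 -t1 -b1.
  rewrite /=; case: insubP => [u uS1 us|ns] /=.
    have [s1 t1 b1] := gJ2 (inr u); have [s2 t2] := aJ u.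
    by rewrite s1 t1 s2 t2 (us : val u = val s).
  have -> : val s = y0.
    by move: ns; rewrite !inE (valP s) andbT negbK => /eqP.
  by rewrite sJ2 tJ2 !othE.
move=> y yS yS0; apply: pull_corner_free.
have yy0 : y != y0 by apply: contraNneq yS0 => ->.
apply: fJ2 => //.
- by rewrite incE aS.
- by rewrite incE bS.
- by apply: inl_neq.
- by rewrite eq_sym inl_neq.
- by apply: inl_neq.
- by apply: fJ => //; rewrite !inE (negPf yS0) andbF.
Qed.

Lemma draw_arcs : exists J : plane_multigraph R V (E + {y | y \in S})%type, drawn J.
Proof. by have [J dJ _] := draw_arcs_sub (subxx S); exists J. Qed.
End DrawArcs.

(** * Spanning forests and Hamilton cycles *)

Section TwoInvolutions.
Variables (T : finType) (D : pred T) (a b : T -> T).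
Hypotheses (aK : involutive a) (bK : involutive b).
Hypotheses (aD : forall d, D d -> D (a d)) (bD : forall d, D d -> D (b d)).
Hypotheses (a_neq : forall d, D d -> a d != d) (b_neq : forall d, D d -> b d != d).

Let phi d := b (a d).

Let phi_inj : injective phi.
Proof. by apply: inj_comp; apply: inv_inj. Qed.

(** Cancelling [b] and [a] on the left replaces [d] by [phi d] and lowers the exponent by two. The
    descent ends at a fixed point of [a] or of [b], and there is none in [D]. *)
Let iter_phi k d : D d -> iter k phi d <> a d.
Proof.
elim/ltn_ind: k d => -[|[|k]] IHk d Dd.
- by move=> /= /eqP; rewrite eq_sym (negPf (a_neq Dd)).
- by move=> /= /eqP; rewrite (negPf (b_neq (aD Dd))).
rewrite iterS iterSr => e; apply: (IHk k _ (phi d)); rewrite ?/phi //.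
  exact/bD/aD.
have h x : phi x = a d -> x = a (phi d) by rewrite /phi => <-; rewrite bK aK.
exact: h.
Qed.

(* The orbits of [b o a] are exchanged in pairs by [a] (and by [b]), and no
   orbit is its own partner. *)
Lemma two_involutions : exists B : pred T,
  forall d, D d -> B (a d) = ~~ B d /\ B (b d) = ~~ B d.
Proof.
have sym : connect_sym (frel phi) by apply: fconnect_sym.
pose r d := enum_rank (froot phi d).
have r_neq d : D d -> r d != r (a d).
  move=> Dd; rewrite (inj_eq enum_rank_inj) root_connect //.
  apply/negP => /iter_findex e; exact: iter_phi Dd e.
have r_phi d : r (phi d) = r d.
  congr enum_rank; apply/eqP; rewrite root_connect // sym.
  exact: (fconnect1 phi).
pose B d := (r d < r (a d))%N.
have Ba d : D d -> B (a d) = ~~ B d.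
  by move=> /r_neq; rewrite /B aK -val_eqE /= => h; rewrite -leqNgt ltn_neqAle eq_sym h.
exists B => d Dd; split; first exact: Ba.
rewrite -Ba // /B aK.
have -> : r (b d) = r (a d) by rewrite -(r_phi (a d)) /phi aK.
by have -> : r (a (b d)) = r d by rewrite -(r_phi (a (b d))) /phi aK bK.
Qed.
End TwoInvolutions.

Section CubicGraph.
Variables (V E : finType) (G : multigraph V E).
Hypotheses (loopG : loopless G) (cubicG : regular G 3).
Variables (X : {set E}) (X_factor : two_factor G X).
Local Notation inc := (incident G).
Local Notation oth := (other_end G).

Lemma degree_inE (A : {pred E}) v : degree_in G A v = #|[pred e in A | inc e v]|.
Proof.
rewrite /degree_in -cardUI [X in (_ + X)%N]eq_card0 ?addn0; last first.
  move=> e; rewrite !inE; apply/negP => /andP[/andP[_ /eqP s] /andP[_ /eqP t]].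
  by have := loopG e; rewrite s t eqxx.
by apply: eq_card => e; rewrite !inE -andb_orr.
Qed.

Lemma joinsC e x y : joins G e x y = joins G e y x.
Proof. by rewrite /joins orbC. Qed.

Lemma joinsP e x y : reflect (inc e x /\ y = oth e x) (joins G e x y).
Proof.
rewrite /joins /incident /other_end; apply: (iffP orP).
  move=> [] /andP[/eqP s /eqP t]; rewrite s t eqxx ?orbT; first by [].
  by split=> //; case: eqP => [<-|].
by have [s|ns] := eqVneq (src G e) x => /= -[] => [_ ->|/eqP -> ->];
  [left|right]; rewrite ?eqxx.
Qed.

Lemma joins_oth e x : inc e x -> joins G e x (oth e x).
Proof. by move=> ex; apply/joinsP. Qed.

Lemma card_X_at v : #|[pred e in X | inc e v]| = 2.
Proof. by rewrite -degree_inE; apply: X_factor. Qed.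

Lemma card_nX_at v : #|[pred e | (e \notin X) && inc e v]| = 1.
Proof.
have h := cubicG v; rewrite /degree degree_inE in h.
have := cardID (mem X) [pred e in predT | inc e v].
rewrite h (_ : #|[predI _ & _]| = 2); last first.
  by rewrite -(card_X_at v); apply: eq_card => e; rewrite !inE andbC.
rewrite (_ : #|[predD _ & _]| = #|[pred e | (e \notin X) && inc e v]|) => [[]//|].
by apply: eq_card => e; rewrite !inE.
Qed.

Lemma chord_exists v : exists e, (e \notin X) && inc e v.
Proof. by have /eqP/card1P[e /(_ e)] := card_nX_at v; rewrite !inE eqxx; exists e. Qed.

Definition chord v : E := xchoose (chord_exists v).

Lemma chordP v : chord v \notin X /\ inc (chord v) v.
Proof. exact/andP/(xchooseP (chord_exists v)). Qed.

Lemma chord_uniq e v : e \notin X -> inc e v -> chord v = e.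
Proof.
have /eqP/card1P[f fE] := card_nX_at v; have [c1 c2] := chordP v => e1 e2.
have := fE e; have := fE (chord v); rewrite !inE c1 c2 e1 e2.
by move=> /esym/eqP-> /esym/eqP->.
Qed.

Definition mate v : V := oth (chord v) v.

Lemma chord_mate v : chord (mate v) = chord v.
Proof.
by have [c1 c2] := chordP v; apply: chord_uniq => //; apply: inc_oth.
Qed.

Lemma mateK : involutive mate.
Proof.
by move=> v; rewrite {1}/mate chord_mate othK //; case: (chordP v).
Qed.

Definition partner v e : E :=
  odflt e [pick f | [&& f \in X, inc f v & f != e]].

Lemma partnerP v e : e \in X -> inc e v ->
  [/\ partner v e \in X, inc (partner v e) v & partner v e != e].
Proof.
move=> eX ev; rewrite /partner; case: pickP => [f /and3P[]//|no].
have := card_X_at v; rewrite (cardD1 e) !inE eX ev /= => -[].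
rewrite eq_card0 // => f; rewrite !inE; have := no f.
by case: (f \in X); case: (inc f v); case: (f == e).
Qed.

Lemma X_at_two v e f g : e \in X -> f \in X -> g \in X ->
  inc e v -> inc f v -> inc g v -> e != f -> g = e \/ g = f.
Proof.
move=> eX fX gX ev fv gv ef; have := card_X_at v.
rewrite (cardD1 e) (cardD1 f) !inE eX ev fX fv (eq_sym f) ef /= => -[/card0_eq/(_ g)].
rewrite !inE gX gv !andbT.
by case: eqP => [->|_]; [right|case: eqP => [->|]; [left|]].
Qed.

Lemma partner_uniq v e f : e \in X -> inc e v -> f \in X -> inc f v ->
  f != e -> partner v e = f.
Proof.
move=> eX ev fX fv fe; have [pX pv pe] := partnerP eX ev.
have ef : e != f by rewrite eq_sym.
by have [h|//] := X_at_two eX fX pX ev fv pv ef; rewrite h eqxx in pe.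
Qed.

Lemma partnerK v e : e \in X -> inc e v -> partner v (partner v e) = e.
Proof.
move=> eX ev; have [pX pv pe] := partnerP eX ev.
by apply: partner_uniq => //; rewrite eq_sym.
Qed.

(* An orientation of the cycles of [X], given by the outgoing edges. *)
Definition orientation (fwd : V -> E) : Prop :=
  [/\ injective fwd, forall v, fwd v \in X /\ inc (fwd v) v &
      forall e, e \in X -> exists v, fwd v = e].

(** On the incident pairs of a vertex and an edge of [X], [a] changes the edge and [b] the vertex. A
    set containing exactly one pair of every two exchanged by [a], and likewise by [b], selects one
    outgoing edge per vertex and one tail per edge. Off these pairs both maps are the identity, so
    that they are involutions everywhere. *)
Lemma orientation_exists : exists fwd, orientation fwd.
Proof.
pose D (d : V * E) := (d.2 \in X) && inc d.2 d.1.
pose a (d : V * E) := if D d then (d.1, partner d.1 d.2) else d.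
pose b (d : V * E) := if D d then (oth d.2 d.1, d.2) else d.
have aD d : D d -> D (a d).
  rewrite /a => Dd; rewrite Dd; move: Dd => /andP[dX dv].
  by have [pX pv _] := partnerP dX dv; rewrite /D /= pX pv.
have bD d : D d -> D (b d).
  rewrite /b => Dd; rewrite Dd; move: Dd => /andP[dX dv].
  by rewrite /D /= dX inc_oth.
have aK : involutive a.
  move=> d; have [Dd|nD] := boolP (D d); last by rewrite /a !(negPf nD).
  have := aD d Dd; rewrite {2}/a /a Dd => ->; move: Dd => /andP[dX dv] /=.
  by rewrite partnerK // -surjective_pairing.
have bK : involutive b.
  move=> d; have [Dd|nD] := boolP (D d); last by rewrite /b !(negPf nD).
  have := bD d Dd; rewrite {2}/b /b Dd => ->; move: Dd => /andP[dX dv] /=.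
  by rewrite othK // -surjective_pairing.
have a_neq d : D d -> a d != d.
  rewrite /a => Dd; rewrite Dd; move: Dd => /andP[dX dv].
  by apply/eqP => /(congr1 snd) /= /eqP; have [_ _ /negPf->] := partnerP dX dv.
have b_neq d : D d -> b d != d.
  rewrite /b => Dd; rewrite Dd; move: Dd => /andP[dX dv].
  by apply/eqP => /(congr1 fst) /= /eqP; rewrite (negPf (oth_neq loopG dv)).
have [B hB] := two_involutions aK bK aD bD a_neq b_neq.
have ex v : exists e, D (v, e) && B (v, e).
  have : 0 < #|[pred e in X | inc e v]| by rewrite card_X_at.
  move=> /card_gt0P[e]; rewrite !inE => /andP[eX ev].
  have Dd : D (v, e) by rewrite /D /= eX.
  have [Be|nB] := boolP (B (v, e)); first by exists e; rewrite Dd.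
  have [Ba _] := hB _ Dd; have Da := aD _ Dd; exists (partner v e).
  by move: Ba Da; rewrite /a Dd /= nB => -> ->.
pose fwd v := xchoose (ex v).
have fwdP v : D (v, fwd v) /\ B (v, fwd v) by apply/andP/(xchooseP (ex v)).
exists fwd; split=> [v w vw|v|e eX].
- have [Dv Bv] := fwdP v; have [Dw Bw] := fwdP w.
  apply/eqP; apply: contraT => nvw; rewrite -vw in Dw Bw.
  have [_ Bb] := hB _ Dv; move: Bb; rewrite /b Dv /=.
  have [/= wv|/= <-] := incP (andP Dv).2 (andP Dw).2; first by rewrite wv eqxx in nvw.
  by rewrite Bv Bw.
- by have [/andP[]] := fwdP v.
suff [v Dv Bv] : exists2 v, D (v, e) & B (v, e).
  exists v; have [Df Bf] := fwdP v; apply/eqP; apply: contraT => nf.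
  have [eX' ev] := andP Dv; have [fX fv] := andP Df.
  have pE : partner v (fwd v) = e by apply: partner_uniq => //; rewrite eq_sym.
  have [] := hB _ Df; rewrite /a Df /= pE Bf Bv; by [].
have Ds : D (src G e, e) by rewrite /D /= eX /incident eqxx.
have [Bs|nB] := boolP (B (src G e, e)); first by exists (src G e).
have [_ Bb] := hB _ Ds; have Db := bD _ Ds; move: Bb Db; rewrite /b Ds /= nB.
by exists (oth e (src G e)).
Qed.

Section Flip.
Variables (fwd : V -> E) (O : pred V).
Hypothesis ori : orientation fwd.
Hypothesis closedO : forall e v, e \in X -> inc e v -> O (oth e v) = O v.

Definition flip v := if O v then partner v (fwd v) else fwd v.

(** Inside [O] the new outgoing edge of a vertex is the one by which it was entered. As [O] consists
    of whole cycles, each edge of [X] still has exactly one tail. *)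
Lemma flip_orientation : orientation flip.
Proof.
have [fi fX fs] := ori.
have flipX v : flip v \in X /\ inc (flip v) v.
  have [vX vv] := fX v; rewrite /flip; case: (O v) => //.
  by have [] := partnerP vX vv.
have partner_other u w : oth (fwd u) u = w -> partner w (fwd w) = fwd u.
  move=> uw; have [uX uu] := fX u; have [wX ww] := fX w.
  apply: partner_uniq => //; first by rewrite -uw inc_oth.
  apply/eqP => /fi e; have := oth_neq loopG uu.
  by rewrite uw e eqxx.
split=> // [v w vw|e eX].
  have [vX vv] := flipX v; have [wX ww] := flipX w.
  have [-> //|wE] : w = v \/ w = oth (flip v) v by apply: incP => //; rewrite vw.
  have Ovw : O w = O v by rewrite wE closedO.
  move: vw vX vv wE; rewrite /flip Ovw; case: (O v) => vw vX vv wE; last exact: fi.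
  have [u uE] := fs _ vX; have [uX uu] := fX u.
  have [uv|uw] : u = v \/ u = w.
    by rewrite -uE in vv wE; have := incP vv uu; rewrite -wE.
  - by have [_ _ /eqP] := partnerP (fX v).1 (fX v).2; rewrite -uE uv.
  - have [_ _ /eqP] := partnerP (fX w).1 (fX w).2.
    by rewrite -vw -uE uw.
have [u uE] := fs e eX; have [uX uu] := fX u.
have [Ou|nO] := boolP (O u); last by exists u; rewrite /flip (negPf nO).
exists (oth (fwd u) u); rewrite /flip closedO // Ou.
by rewrite (partner_other u).
Qed.
End Flip.
End CubicGraph.

(** * Trees of cycles and the merging of orbits *)

Section Forest.
Variables (V E : finType) (G : multigraph V E).
Hypotheses (loopG : loopless G) (cubicG : regular G 3).
Variables (X : {set E}) (X_factor : two_factor G X).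
Local Notation inc := (incident G).
Local Notation oth := (other_end G).

Local Notation chord := (chord loopG cubicG X_factor).
Local Notation mate := (mate loopG cubicG X_factor).

Definition join_adj (T : seq E) : rel V :=
  adj_in G [pred e | (e \in X) || (e \in T)].

Local Notation conn T := (connect (join_adj T)).

Lemma adj_inP (A : {pred E}) x y :
  reflect (exists2 e, e \in A & joins G e x y) (adj_in G A x y).
Proof. exact: exists_inP. Qed.

Lemma adj_in_sym (A : {pred E}) : connect_sym (adj_in G A).
Proof.
apply: sym_connect_sym => x y; apply/adj_inP/adj_inP => -[e eA exy];
  by exists e => //; rewrite joinsC.
Qed.

Lemma conn_edge T e v : (e \in X) || (e \in T) -> inc e v -> conn T v (oth e v).
Proof.
by move=> eT ev; apply/connect1/adj_inP; exists e => //; apply: joins_oth.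
Qed.

Lemma conn_sub T T' : {subset T <= T'} -> subrel (conn T) (conn T').
Proof.
move=> sT; apply: connect_sub => x y /adj_inP[e eT exy]; apply/connect1/adj_inP.
exists e => //; move: eT; rewrite !inE => /orP[->//|/sT ->]; exact: orbT.
Qed.

(** Acyclicity after contraction of the cycles of [X]; the list also records an order of
    construction, with the latest edge at its head. *)
Fixpoint forest (T : seq E) : Prop :=
  if T is e :: T' then
    [/\ e \notin X, ~~ conn T' (src G e) (tgt G e) & forest T']
  else True.

Lemma conn_ends T e v w : inc e v -> inc e w -> (e \in X) || (e \in T) ->
  conn T v w.
Proof.
by move=> ev ew eT; have [->|->] := incP ev ew; [exact: connect0|apply: conn_edge].
Qed.

Lemma inc_src e : inc e (src G e).
Proof. by rewrite /incident eqxx. Qed.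

Lemma inc_tgt e : inc e (tgt G e).
Proof. by rewrite /incident eqxx orbT. Qed.

Lemma forest_uniq T : forest T -> uniq T.
Proof.
elim: T => //= e T IHT [eX nc fT]; rewrite IHT // andbT.
apply: contra nc => eT; apply: conn_ends (inc_src e) (inc_tgt e) _.
by rewrite eT orbT.
Qed.

Lemma forest_apart T e : forest T -> e \in T ->
  ~~ conn [::] (src G e) (tgt G e).
Proof.
elim: T => //= f T IHT [_ nc fT]; rewrite inE => /orP[/eqP->|]; last exact: IHT.
by apply: contra nc; apply: conn_sub.
Qed.

(** Of two edges joining the same two cycles, the later one would have had its ends connected
    already. This is used for the simplicity of [J]. *)
Lemma forest_not_parallel T e f u v u' v' : forest T -> e \in T -> f \in T ->
  joins G e u v -> joins G f u' v' -> conn [::] u u' -> conn [::] v v' -> e = f.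
Proof.
have base e' f' T' a b a' b' : f' \in T' -> joins G e' a b -> joins G f' a' b' ->
    conn [::] a a' -> conn [::] b b' -> conn T' (src G e') (tgt G e').
  move=> fT /joinsP[ea ->] /joinsP[fa ->] ca cb.
  have sub := @conn_sub [::] T'; have symT := @adj_in_sym _.
  have ab : conn T' a (oth e' a).
    apply: connect_trans (sub _ _ _ ca) _ => //.
    apply: connect_trans (conn_edge _ fa) _; first by rewrite fT orbT.
    by rewrite symT; apply: sub.
  have [s|s] := incP ea (inc_src e'); have [t|t] := incP ea (inc_tgt e');
    by rewrite s t ?connect0 // symT.
elim: T => //= g T IHT [_ nc fT]; rewrite !inE => eT f'T ej fj cu cv.
move: eT f'T => /orP[/eqP eg|eT] /orP[/eqP fg|f'T]; first by rewrite eg fg.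
- by case/negP: nc; rewrite -eg; apply: (base _ f _ _ _ _ _ f'T ej fj).
- case/negP: nc; rewrite -fg; apply: (base _ e _ _ _ _ _ eT fj ej).
    by rewrite adj_in_sym.
  by rewrite adj_in_sym.
- exact: IHT.
Qed.

(** Greedy extension: if some edge has unconnected ends, it can be put in front. A forest has no
    repeated edges, so this stops after at most [#|E|] rounds. *)
Lemma forest_exists : connected_graph G ->
  exists2 T, forest T & forall x y, conn T x y.
Proof.
move=> cG; suff H n : forall T, forest T -> #|E| - size T <= n ->
    exists2 T, forest T & forall x y, conn T x y.
  exact: (H #|E| [::] _ (leq_subr _ _)).
elim: n => [|n IHn] T fT Tn.
  exists T => // x y; apply: (connect_sub _ (cG x y)) => {}x {}y /adj_inP[e _ exy].
  apply/connect1/adj_inP; exists e => //; rewrite !inE; apply/orP; right.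
  have /card_uniqP sT := forest_uniq fT.
  have : T =i E; last by move=> ->.
  apply/subset_cardP; last exact/subsetP.
  by apply/anti_leq; rewrite sT -{1}sT max_card -subn_eq0 -leqn0.
have [/forallP con|] := boolP [forall e, conn T (src G e) (tgt G e)].
  exists T => // x y; apply: (connect_sub _ (cG x y)) => {}x {}y /adj_inP[e _ exy].
  by move: exy => /orP[]/andP[/eqP<- /eqP<-] //; rewrite adj_in_sym.
rewrite negb_forall => /existsP[e nc].
have feT : forest (e :: T).
  split=> //; apply: contra nc => eX; apply: conn_ends (inc_src e) (inc_tgt e) _.
  by rewrite eX.
by apply: (IHn (e :: T)) => //=; rewrite subnS -subn1 leq_subLR add1n.
Qed.

Lemma consistent_orientation (left : V -> E -> bool) T :
  (forall v e, e \in X -> inc e v -> left v (partner G X v e) = ~~ left v e) ->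
  forest T ->
  exists2 fwd, orientation G X fwd & forall e, e \in T ->
    left (src G e) (fwd (src G e)) = left (tgt G e) (fwd (tgt G e)).
Proof.
move=> leftN; elim: T => [_|e T IHT /= [eX nc fT]].
  by have [fwd ori] := orientation_exists loopG X_factor; exists fwd.
have [fwd ori cons] := IHT fT.
have [le|nle] := eqVneq (left (src G e) (fwd (src G e)))
    (left (tgt G e) (fwd (tgt G e))).
  by exists fwd => // f; rewrite inE => /orP[/eqP->|/cons].
pose O v := conn T (src G e) v.
have closedO f v : (f \in X) || (f \in T) -> inc f v -> O (oth f v) = O v.
  move=> fXT fv; apply/idP/idP => h; apply: connect_trans h _; last exact: conn_edge.
  by rewrite adj_in_sym; apply: conn_edge.
exists (flip G X fwd O).
  by apply: flip_orientation => // f v fX fv; apply: closedO; rewrite ?fX.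
have [_ fX _] := ori.
have leftF v : left v (flip G X fwd O v) = O v (+) left v (fwd v).
  by rewrite /flip; case: (O v) => //; rewrite leftN ?addTb //; case: (fX v).
move=> f; rewrite inE !leftF => /orP[/eqP->|fT'].
  rewrite /O connect0 (negPf nc) /=.
  by move: nle; do 2 case: (left _ _).
rewrite cons //; congr (_ (+) _).
have [->//|->] := incP (inc_src f) (inc_tgt f).
by rewrite closedO ?fT' ?orbT // inc_src.
Qed.

Section Successor.
Variable fwd : V -> E.
Hypothesis ori : orientation G X fwd.

Definition succ v : V := oth (fwd v) v.

(** The edge entering [succ u] is the partner of the edge leaving it, so [succ u] determines
    [fwd u]. *)
Lemma succ_inj : injective succ.
Proof.
have [fi fX _] := ori; move=> v w vw; apply: (fi).
have back u : fwd u = partner G X (succ u) (fwd (succ u)).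
  have [uX uu] := fX u; have [sX ss] := fX (succ u).
  apply/esym/(partner_uniq loopG X_factor) => //; first exact: inc_oth.
  apply/eqP => /fi e; have := oth_neq loopG uu.
  by rewrite -/(succ u) -e eqxx.
by rewrite (back v) vw -back.
Qed.

Definition succ_perm : {perm V} := perm succ_inj.

Fixpoint merged (T : seq E) : {perm V} :=
  if T is e :: T' then (tperm (src G e) (tgt G e) * merged T')%g else succ_perm.

Lemma succ_conn T v : conn T v (succ v).
Proof. by have [_ fX _] := ori; have [vX vv] := fX v; apply: conn_edge; rewrite ?vX. Qed.

Lemma porbit_trans (s : {perm V}) x y z :
  y \in porbit s x -> z \in porbit s y -> z \in porbit s x.
Proof. by rewrite -!eq_porbit_mem => /eqP <-. Qed.

Lemma porbit_step (s : {perm V}) x : s x \in porbit s x.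
Proof. by have := mem_porbit s 1 x; rewrite expg1. Qed.

Lemma porbit_connect (s : {perm V}) (e : rel V) : connect_sym e ->
  (forall x, connect e x (s x)) -> (forall x y, e x y -> y \in porbit s x) ->
  forall x y, connect e x y = (y \in porbit s x).
Proof.
move=> sym es se x y; apply/idP/idP => [/connectP[p]|/porbitP[i ->]].
  elim: p x => [|z p IHp] x /=; first by move=> _ ->; apply: porbit_id.
  by move=> /andP[/se xz zp] /(IHp _ zp); apply: porbit_trans.
elim: i => [|i IHi]; first by rewrite expg0 perm1.
by rewrite expgSr permM; apply: connect_trans IHi (es _).
Qed.

(** A transposition of two elements in different orbits fuses these orbits. The forest condition
    says that the ends of the next edge lie in different orbits, so each edge lowers the number of
    orbits by one. *)
Lemma merged_orbits T : forest T ->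
  (forall x y, conn T x y = (y \in porbit (merged T) x)) /\
  #|porbits (merged T)| + size T = #|porbits succ_perm|.
Proof.
elim: T => [_|e T IHT [eX nc fT]].
  split=> [|/=]; last by rewrite addn0.
  apply: porbit_connect => [|x|x y /adj_inP[e]].
  - exact: adj_in_sym.
  - by rewrite permE; apply: succ_conn.
  rewrite !inE orbF => eX /joinsP[ex ->].
  have [fi fX fs] := ori; have [u uE] := fs e eX; have [uX uu] := fX u.
  have [xu|xu] : x = u \/ x = succ u by rewrite -uE in ex; apply: incP ex.
    have -> : oth e x = succ_perm x by rewrite permE /succ -uE xu.
    exact: porbit_step.
  rewrite porbit_sym xu -uE [oth _ _]othK //.
  have -> : succ u = succ_perm u by rewrite permE.
  exact: porbit_step.
have [orbE countT] := IHT fT.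
set x := src G e in nc *; set y := tgt G e in nc *.
set s := merged T in orbE countT *.
have nxy : x \notin porbit s y by rewrite porbit_sym -orbE.
have xy : x != y by rewrite loopG.
have c1 := porbits_mul_tperm s x y; rewrite nxy xy /= in c1.
(* The counting identity is used a second time, for the product, which the same transposition turns
   back into [s]. If [x] and [y] were in different orbits of the product, the number of orbits would
   drop again, contrary to [c1]. *)
have c2 := porbits_mul_tperm (tperm x y * s) x y.
rewrite /= mulgA tperm2 mul1g xy in c2.
have xy2 : x \in porbit (tperm x y * s) y.
  apply: contraT => h; rewrite h /= in c2; lia.
split; last first.
  rewrite /= -/x -/y -/s -countT addnS -addSn; congr (_ + _).
  by move: c1; rewrite addn1 !addnS addn0 => -[].
rewrite [merged _]/= -/x -/y -/s.
have step z : s z \in porbit (tperm x y * s) z.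
  have [->|zx] := eqVneq z x.
    have -> : s x = (tperm x y * s)%g y by rewrite permM tpermR.
    by apply: porbit_trans (porbit_step _ _); rewrite porbit_sym.
  have [->|zy] := eqVneq z y.
    have -> : s y = (tperm x y * s)%g x by rewrite permM tpermL.
    exact: porbit_trans xy2 (porbit_step _ _).
  have -> : s z = (tperm x y * s)%g z by rewrite permM tpermD // eq_sym.
  exact: porbit_step.
have sub z w : w \in porbit s z -> w \in porbit (tperm x y * s) z.
  move=> /porbitP[i ->]; elim: i => [|i IHi]; first by rewrite expg0 perm1 porbit_id.
  by rewrite expgSr permM; apply: porbit_trans IHi (step _).
have subT : subrel (conn T) (conn (e :: T)).
  by apply: conn_sub => f fT'; rewrite inE fT' orbT.
have exy : conn (e :: T) x y.
  by apply: conn_ends (inc_src e) (inc_tgt e) _; rewrite mem_head orbT.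
apply: porbit_connect => [|z|z w /adj_inP[f]].
- exact: adj_in_sym.
- rewrite permM; apply: connect_trans (_ : conn (e :: T) z (tperm x y z)) _.
    by case: tpermP => [->|->|_ _] //; rewrite ?connect0 // adj_in_sym.
  by apply: subT; rewrite orbE porbit_step.
rewrite !inE orbA (orbC _ (f == e)) -orbA => /orP[/eqP-> /joinsP[ez ->]|fT' fzw].
  have [zx|zy] := incP (inc_src e) ez.
    by rewrite zx /other_end eqxx -/y -/x porbit_sym.
  by rewrite zy othK ?inc_src // /other_end eqxx.
by apply: sub; rewrite -orbE; apply/connect1/adj_inP; exists f.
Qed.

Lemma components_porbits : components_in G (mem X) = #|porbits succ_perm|.
Proof.
have [orb0 _] := merged_orbits (T := [::]) I.
have orb x y : connect (adj_in G (mem X)) x y = (y \in porbit succ_perm x).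
  rewrite -orb0; apply: eq_connect => {}x {}y; apply/adj_inP/adj_inP;
  by move=> [e eX exy]; exists e; rewrite // !inE ?orbF in eX *.
have sym := adj_in_sym (mem X).
rewrite /components_in /n_comp_mem.
pose e := adj_in G (mem X).
have -> : porbits succ_perm = porbit succ_perm @: [set x | fingraph.roots e x].
  apply/setP => A; apply/imsetP/imsetP => [[x _ ->]|[x _ ->]]; last by exists x.
  exists (fingraph.root e x); first by rewrite inE roots_root.
  by apply/eqP; rewrite eq_porbit_mem -orb sym connect_root.
rewrite card_in_imset.
  by apply: eq_card => x; rewrite !inE andbT.
move=> x y; rewrite !inE => /eqP rx /eqP ry /eqP; rewrite eq_porbit_mem -orb sym.
by rewrite -root_connect // rx ry => /eqP.
Qed.

(** Only one chord ends at each vertex, so the transpositions are disjoint and at most one of them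
    moves [v]. *)
Lemma mergedE T v : forest T ->
  merged T v = succ (if chord v \in T then mate v else v).
Proof.
elim: T v => [|e T IHT] v; first by rewrite permE.
move=> fT; have eT : e \notin T by have /= /andP[] := forest_uniq fT.
move: fT => /= [eX _ fT]; rewrite permM IHT // in_cons.
have cs : chord (src G e) = e by apply: chord_uniq => //; apply: inc_src.
have ct : chord (tgt G e) = e by apply: chord_uniq => //; apply: inc_tgt.
have ms : mate (src G e) = tgt G e by rewrite /mate cs /other_end eqxx.
have mt : mate (tgt G e) = src G e by rewrite -ms mateK.
case: tpermP => [->|->|vs vt].
- by rewrite ct cs eqxx (negPf eT) ms.
- by rewrite ct cs eqxx (negPf eT) mt.
suff /negPf-> : chord v != e by [].
apply/eqP => ce; have [_ cv] := chordP loopG cubicG X_factor v.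
move: cv; rewrite -/(chord v) ce /incident => /orP[]/eqP e'; first exact: vs.
exact: vt.
Qed.

Lemma card_forest_vertices T : forest T ->
  #|[set v | chord v \in T]| = (2 * size T)%N.
Proof.
elim: T => [_|e T IHT]; first by apply: eq_card0 => v; rewrite !inE.
move=> fT; have eT : e \notin T by have /= /andP[] := forest_uniq fT.
move: fT => /= [eX _ fT]; rewrite mulnS -(IHT fT).
have cs : chord (src G e) = e by apply: chord_uniq => //; apply: inc_src.
have ct : chord (tgt G e) = e by apply: chord_uniq => //; apply: inc_tgt.
have -> : [set v | chord v \in e :: T] =
    src G e |: (tgt G e |: [set v | chord v \in T]).
  apply/setP => v; rewrite !inE orbA; congr (_ || _); apply/eqP/orP.
    have [_ cv] := chordP loopG cubicG X_factor v; move=> ce.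
    by move: cv; rewrite -/(chord v) ce => /orP[]; rewrite eq_sym; [left|right].
  by move=> [] /eqP->.
by rewrite !cardsU1 !inE cs ct (negPf eT) (negPf (loopG e)) addnA.
Qed.


End Successor.
End Forest.

(** * Free corners at vertices of degree three *)

Section Corners.
Variables (R : realType) (V E : finType) (G : plane_multigraph R V E).
Hypotheses (loopG : loopless G) (cubicG : regular G 3).
Variables (X : {set E}) (X_factor : two_factor G X).
Local Notation chord := (chord loopG cubicG X_factor).
Local Notation partner := (partner G X).
Local Notation vp := (vpoint G).

(** Edges that do not end at [v] stay at a positive distance from it, so only the position of [f]
    matters. *)
Lemma corner_free_three v e f g : (forall h, incident G h v -> [|| h == e, h == f | h == g]) ->
  incident G f v -> cyc (vp v) (dir G e v) (dir G f v) (dir G g v) ->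
  corner_free G e v g.
Proof.
move=> efg fv c.
pose far u := exists2 h, ~~ incident G h v & edge_set G h u.
have tf : tame far by apply: tame_bigU => h; apply: tame_polyline.
apply: (@sector_free_sub _ (fun u => edge_set G f u \/ far u)).
  move=> u [h /andP[he hg] hu]; have [hv|hv] := boolP (incident G h v).
    by left; have := efg h hv; rewrite (negPf he) (negPf hg) orbF => /eqP <-.
  by right; exists h.
apply: sector_free_union; first exact: edge_sector.
apply: sector_free_away; first by case: tf.
by move=> [h nh /edge_set_vpoint hv]; rewrite hv in nh.
Qed.

(* The edge [e] of [X] at [v] comes next counterclockwise after the chord. *)
Definition left_turn v e : bool :=
  cyc (vp v) (dir G e v) (dir G (partner v e) v) (dir G (chord v) v).

(** Exchanging the two edges of [X] reverses the cyclic order, and exactly one of the two cyclic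
    orders of three distinct rays holds. *)
Lemma left_turn_partner v e : e \in X -> incident G e v ->
  left_turn v (partner v e) = ~~ left_turn v e.
Proof.
move=> eX ev; have [pX pv pe] := partnerP loopG X_factor eX ev.
have [cX cv] := chordP loopG cubicG X_factor v.
rewrite /left_turn (partnerK loopG) //.
have div h k : h != k -> incident G h v -> incident G k v ->
  diverge (vp v) (dir G h v) (dir G k v) by apply: dir_diverge.
have ep : e != partner v e by rewrite eq_sym.
have pc : partner v e != chord v by apply: contraNneq cX => <-.
have ce : chord v != e by apply: contraNneq cX => ->.
have := cyc_total (div _ _ ep ev pv) (div _ _ pc pv cv) (div _ _ ce cv ev).
have := @cyc_asym _ (vp v) (dir G e v) (dir G (partner v e) v) (dir G (chord v) v).
rewrite [cyc _ (dir G (partner v e) v) _ _]cyc_rot.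
by case: (cyc _ _ _ _) => [/(_ isT)/negPf->|_ /= ->].
Qed.

Lemma inc_three v e h : e \in X -> incident G e v -> incident G h v ->
  [|| h == e, h == partner v e | h == chord v].
Proof.
move=> eX ev hv; have [hX|hX] := boolP (h \in X); last first.
  by rewrite (chord_uniq loopG cubicG X_factor hX hv) eqxx !orbT.
have [he|he] := eqVneq h e => //=.
by rewrite (partner_uniq loopG X_factor eX ev hX hv he) eqxx.
Qed.

Lemma left_turn_free v e : e \in X -> incident G e v -> left_turn v e ->
  corner_free G e v (chord v).
Proof.
move=> eX ev; have [pX pv _] := partnerP loopG X_factor eX ev.
by apply: corner_free_three => // h; apply: inc_three.
Qed.

Lemma right_turn_free v e : e \in X -> incident G e v -> ~~ left_turn v e ->
  corner_free G (chord v) v e.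
Proof.
move=> eX ev; rewrite -left_turn_partner // /left_turn (partnerK loopG) // => c.
have [pX pv _] := partnerP loopG X_factor eX ev.
apply: (corner_free_three (f := partner v e)) => //.
  by move=> h hv; have /or3P[->|->|->] := inc_three eX ev hv; rewrite ?orbT.
by rewrite -cyc_rot -cyc_rot.
Qed.
End Corners.

Theorem theorem1p1 (R : realType) (V E : finType)
    (G : plane_multigraph R V E)
    (G_regular : regular G 3)
    (G_two_connected : two_connected G)
    (G_loopless : loopless G)
    (X : {set E}) (X_two_factor : two_factor G X)
    (n : nat) (X_components : components_in G (mem X) = n) :
  exists (F : finType) (J : plane_multigraph R V F) (iota : E -> F)
         (c : seq (V * F)),
    [/\ plane_subgraph G J iota /\ sub_square J G,
        hamilton_cycle J c /\
          (forall e : E, e \notin X -> iota e \notin [seq a.2 | a <- c]),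
        #|F| = (#|E| + 2 * n - 2)%N,
        (max_degree J <= 5)%N
      & simple_graph G -> simple_graph J].
Proof.
have [V1 G_connected _] := G_two_connected.
pose ch := chord G_loopless G_regular X_two_factor.
pose mt := mate G_loopless G_regular X_two_factor.
pose left := left_turn G_loopless G_regular X_two_factor.
have [T fT conT] := forest_exists X G_connected.
have [fwd ori cons] := consistent_orientation G_loopless X_two_factor
  (@left_turn_partner _ _ _ _ G_loopless G_regular _ X_two_factor) fT.
have [fwd_inj fwdX _] := ori.
pose sc := succ G fwd.
pose S := [set v | ch v \in T].
(* The path at [v] enters along [a v] and leaves along [b v]; the direction is chosen so that the
   third edge at [v] lies on its right. *)
pose a v := if left v (fwd v) then fwd v else ch v.
pose b v := if left v (fwd v) then ch v else fwd v.
have chX v : ch v \notin X by have [] := chordP G_loopless G_regular X_two_factor v.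
have chv v : incident G (ch v) v by have [] := chordP G_loopless G_regular X_two_factor v.
have mtK : involutive mt by apply: mateK.
have ch_mt v : ch (mt v) = ch v by apply: chord_mate.
have mtS v : (mt v \in S) = (v \in S) by rewrite !inE ch_mt.
have fwd_ch v w : fwd v != ch w.
  by apply: contraNneq (chX w) => <-; have [] := fwdX v.
have left_mt v : v \in S -> left (mt v) (fwd (mt v)) = left v (fwd v).
  rewrite inE => vT; have := cons _ vT.
  have := G_loopless (ch v).
  by have [->|->] := incP (chv v) (inc_src G (ch v));
    have [->|->] := incP (chv v) (inc_tgt G (ch v)); rewrite ?eqxx.
have sc_conn v : connect (join_adj G X [::]) v (sc v) by apply: succ_conn.
have symX := adj_in_sym G [pred e | (e \in X) || (e \in [::])].
have apart v : v \in S -> ~~ connect (join_adj G X [::]) v (mt v).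
  rewrite inE => vT; have := forest_apart fT vT; apply: contra => vm.
  have [->|->] := incP (chv v) (inc_src G (ch v));
    have [->|->] := incP (chv v) (inc_tgt G (ch v)); rewrite ?connect0 //.
  by rewrite symX.
have mt_sc v : v \in S -> mt v != sc v.
  by move=> vS; apply: contraNneq (apart v vS) => ->.
have aS : {in S, forall y, incident G (a y) y}.
  by move=> y _; rewrite /a; case: (left _ _); [case: (fwdX y)|apply: chv].
have bS : {in S, forall y, incident G (b y) y}.
  by move=> y _; rewrite /b; case: (left _ _); [apply: chv|case: (fwdX y)].
have ends : {in S, forall y, other_end G (a y) y != other_end G (b y) y}.
  move=> y yS; have := mt_sc y yS; rewrite /a /b.
  by case: (left _ _); rewrite // eq_sym.
(* An edge in both roles would be the outgoing edge of one vertex, which has only one role, or a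
   chord seen from its two ends, where [left_mt] gives equal roles. *)
have abS : {in S &, forall y y', a y != b y'}.
  move=> y y' yS y'S; rewrite /a /b; case: ifP => l; case: ifP => l' //.
  - by apply: contraTneq l => /fwd_inj ->; rewrite l'.
  - apply: contraFneq l => yy'; have ey' : incident G (ch y) y' by rewrite yy'; apply: chv.
    have [e|e] := incP (chv y) ey'; first by rewrite -e.
    by rewrite -left_mt // (_ : mt y = y').
  - by rewrite eq_sym.
have frS : {in S, forall y, corner_free G (a y) y (b y)}.
  move=> y _; have [fX fv] := fwdX y; rewrite /a /b; case: ifP => l.
    exact: left_turn_free.
  by apply: right_turn_free => //; rewrite -/left l.
have [J [vJ gJ aJ]] := draw_arcs G_loopless aS bS ends abS frS.
pose F := (E + {y | y \in S})%type.
have joins_inl e x y : joins J (inl e) x y = joins G e x y.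
  by have [s t _] := gJ e; rewrite /joins s t.
have ends_inr s : src J (inr s) = mt (val s) /\ tgt J (inr s) = sc (val s) \/
    src J (inr s) = sc (val s) /\ tgt J (inr s) = mt (val s).
  have [-> ->] := aJ s; rewrite /a /b; case: (left _ _); by [right|left].
have joins_inr s : joins J (inr s) (mt (val s)) (sc (val s)).
  by rewrite /joins; have [[-> ->]|[-> ->]] := ends_inr s; rewrite !eqxx ?orbT.
have joins_inrE s x y : joins J (inr s) x y ->
    x = mt (val s) /\ y = sc (val s) \/ x = sc (val s) /\ y = mt (val s).
  rewrite /joins; have [[-> ->]|[-> ->]] := ends_inr s;
    move=> /orP[] /andP[/eqP-> /eqP->]; by [left|right].
(* The new edge with index [y] runs from the mate of [y] to the successor of [y], so the one to be
   followed from [v] has index [mt v]. *)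
pose nxt v : F := if insub (mt v) is Some s then inr s else inl (fwd v).
pose s := merged G_loopless X_two_factor ori T.
have nxt_joins v : joins J (nxt v) v (s v).
  rewrite /s (mergedE _ G_regular) // -/ch -/mt /nxt; case: insubP => [u uS uE|nS].
    have -> : ch v \in T by move: uS; rewrite mtS inE.
    by have := joins_inr u; rewrite uE mtK.
  have /negPf-> : ch v \notin T by move: nS; rewrite mtS inE.
  by rewrite joins_inl; apply: joins_oth; case: (fwdX v).
have nxt_inj : injective nxt.
  move=> v w; rewrite /nxt; case: insubP => [u uS uE|nS]; case: insubP => [u' u'S u'E|nS'] //.
    by move=> [uu]; apply: (inv_inj mtK); rewrite -uE -u'E uu.
  by move=> [/fwd_inj].
have [v0 _] : exists v0 : V, true by have /card_gt0P[v0 _] := ltnW V1; exists v0.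
have [orbT' countT] := merged_orbits G_loopless X_two_factor ori fT.
rewrite -/s in orbT' countT.
have s_inj : injective s by apply: perm_inj.
have in_orb v : v \in fingraph.orbit s v0.
  rewrite -fconnect_orbit; have := conT v0 v; rewrite orbT' => /porbitP[i ->].
  by rewrite permX; apply: fconnect_iter.
(* The 1 is the single orbit that is left once all cycles have been merged. *)
have sizeT : (1 + size T = n)%N.
  rewrite -X_components (components_porbits G_loopless X_two_factor ori) -countT.
  congr (_ + _)%N; apply/esym/eqP/cards1P; exists (porbit s v0); apply/setP => A.
  rewrite inE; apply/imsetP/eqP => [[x _ ->]|->]; last by exists v0.
  by apply/eqP; rewrite eq_porbit_mem -orbT' adj_in_sym conT.
have cardS : #|S| = (2 * size T)%N := card_forest_vertices G_loopless G_regular X_two_factor fT.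
exists F, J, inl, [seq (v, nxt v) | v <- fingraph.orbit s v0]; split.
- split.
    split=> // [e e' []//|v|e]; first by rewrite vJ.
    have [s1 t1 b1] := gJ e; rewrite /edge_set /curve /corners.
    by rewrite s1 t1 b1 vJ.
  have adj_edge e x y : joins G e x y -> adj G x y.
    by move=> exy; apply/adj_inP; exists e.
  have joins_neq e x y : joins G e x y -> x != y.
    by move=> /joinsP[ex ->]; rewrite eq_sym oth_neq.
  move=> [e|u] x y.
    rewrite joins_inl => exy; split; first exact: joins_neq exy.
    by exists [:: y]; rewrite /= (adj_edge e).
  have yS := valP u; have [fX fv] := fwdX (val u).
  have j1 := joins_oth (chv (val u)); have j2 := joins_oth fv.
  move=> /joins_inrE[[-> ->]|[-> ->]].
    split; first exact: mt_sc.
    exists [:: val u; sc (val u)]; split=> //=.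
    rewrite (adj_edge (ch (val u))) 1?joinsC //.
    by rewrite (adj_edge (fwd (val u))).
  split; first by rewrite eq_sym; apply: mt_sc.
  exists [:: val u; mt (val u)]; split=> //=.
  rewrite (adj_edge (fwd (val u))) 1?joinsC //.
  by rewrite (adj_edge (ch (val u))).
- split; last first.
    move=> e eX; apply/negP; rewrite -map_comp => /mapP[v _] /=.
    rewrite /nxt; case: insubP => // _ [eE].
    by rewrite eE (fwdX v).1 in eX.
  split; last by move=> v; rewrite -map_comp map_id_in.
  split.
  + by rewrite -size_eq0 size_map size_orbit -lt0n fingraph.order_gt0.
  + by rewrite -map_comp map_id_in // orbit_uniq.
  + by rewrite -map_comp map_inj_uniq ?orbit_uniq.
  rewrite cycle_map; apply: sub_cycle (cycle_orbit s_inj v0).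
  by move=> v w /= /eqP <-.
- rewrite card_sum card_sig -[X in (_ + X)%N]/(#|S|) cardS -sizeT; lia.
- apply/bigmax_leqP => v _; rewrite /degree /degree_in.
  have cardF (P : pred F) : #|[pred f in predT | P f]| =
      (#|[pred e in predT | P (inl e)]| + #|[pred u | P (inr u)]|)%N.
    by rewrite -!sum1_card big_sumType /=.
  rewrite !cardF.
  have c1 : #|[pred e in predT | src J (inl e) == v]| =
      #|[pred e in predT | src G e == v]|.
    by apply: eq_card => e; rewrite !inE; have [-> _ _] := gJ e.
  have c2 : #|[pred e in predT | tgt J (inl e) == v]| =
      #|[pred e in predT | tgt G e == v]|.
    by apply: eq_card => e; rewrite !inE; have [_ -> _] := gJ e.
  rewrite c1 c2; have := G_regular v; rewrite /degree /degree_in addnACA => ->.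
  rewrite -[5]/(3 + 2)%N leq_add2l.
  suff : (#|[pred u | src J (inr u) == v]| + #|[pred u | tgt J (inr u) == v]| <= 2)%N.
    by [].
  (* Which end of a new edge is its source depends on [left], so the two counts can only be
     rewritten together. Afterwards each is at most 1, as [mt] and [sc] are injective. *)
  have -> : (#|[pred u | src J (inr u) == v]| + #|[pred u | tgt J (inr u) == v]| =
     #|[pred u : {y | y \in S} | mt (val u) == v]| +
     #|[pred u : {y | y \in S} | sc (val u) == v]|)%N.
    have cardE (P : pred {y | y \in S}) : #|[pred u | P u]| = (\sum_u P u)%N.
      by rewrite -sum1_card big_mkcond; apply: eq_bigr => u _; rewrite inE; case: (P u).
    rewrite !cardE -!big_split; apply: eq_bigr => u _ /=.
    by have [[-> ->]|[-> ->]] := ends_inr u; rewrite // addnC.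
  have c3 : (#|[pred u : {y | y \in S} | mt (val u) == v]| <= 1)%N.
    apply/card_le1_eqP => u u'; rewrite !inE => /eqP <- /eqP e.
    by apply/val_inj/(inv_inj mtK).
  have c4 : (#|[pred u : {y | y \in S} | sc (val u) == v]| <= 1)%N.
    apply/card_le1_eqP => u u'; rewrite !inE => /eqP <- /eqP e.
    by apply/val_inj/(succ_inj G_loopless X_two_factor ori).
  exact: leq_add c3 c4.
move=> [_ simpG]; split.
  move=> [e|u]; first by have [-> -> _] := gJ e; apply: G_loopless.
  have := mt_sc _ (valP u).
  by have [[-> ->]|[-> ->]] := ends_inr u; rewrite // eq_sym.
(* An edge of [X] would put [y] and its mate on the same cycle. Any other edge would be the chord at
   the mate, making [y] its own successor. *)
have no_par e (u : {y | y \in S}) : joins G e (mt (val u)) (sc (val u)) -> False.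
  set y := val u => /joinsP[em scE]; have yS : y \in S := valP u.
  have [eX|eX] := boolP (e \in X).
    case/negP: (apart y yS); apply: connect_trans (sc_conn y) _.
    by rewrite symX scE; apply: conn_edge; rewrite ?eX.
  have ce : ch (mt y) = e by apply: chord_uniq.
  have : sc y = y by rewrite scE -ce; apply: mtK.
  have [fX fv] := fwdX y; move=> /eqP; apply/negP; exact: oth_neq.
move=> [e|u] [f|u'] x y.
- by rewrite !joins_inl => j1 j2; rewrite (simpG e f x y).
- rewrite joins_inl => ej /joins_inrE[[xE yE]|[xE yE]]; subst x y.
    by case: (no_par e u').
  by case: (no_par e u'); rewrite joinsC.
- rewrite joins_inl => /joins_inrE[[xE yE]|[xE yE]] ej; subst x y.
    by case: (no_par f u).
  by case: (no_par f u); rewrite joinsC.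
have uS := valP u; have u'S := valP u'.
(* The chords at [u] and [u'] would join the same two cycles and hence coincide, so [u'] is [u] or
   its mate. The first makes mate and successor of [u] equal, the second makes the mate its own
   successor. *)
have no_cross : mt (val u) = sc (val u') -> sc (val u) = mt (val u') -> False.
  move=> e1 e2; have cc : ch (val u) = ch (val u').
    apply: (forest_not_parallel fT (u := val u) (v := mt (val u))
      (u' := mt (val u')) (v' := val u')).
    - by rewrite inE in uS.
    - by rewrite inE in u'S.
    - by apply: joins_oth; apply: chv.
    - by rewrite joinsC; apply: joins_oth; apply: chv.
    - by rewrite -e2; apply: sc_conn.
    - by rewrite symX e1; apply: sc_conn.
  have cu' : incident G (ch (val u)) (val u') by rewrite cc; apply: chv.
  have [uu|uu] := incP (chv (val u)) cu'.
  - by have /eqP := mt_sc _ uS; rewrite e1 uu.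
  - have [fX fv] := fwdX (mt (val u)).
    by have /eqP := oth_neq G_loopless fv; apply; rewrite [RHS]e1 uu.
move=> /joins_inrE j /joins_inrE j'; congr inr; apply: val_inj.
case: j j' => -[-> ->] [[e1 e2]|[e1 e2]].
- exact: (inv_inj mtK).
- by case: no_cross.
- by case: no_cross.
- exact: (inv_inj mtK).
Qed.
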